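(* Let $p<q$ be odd primes, and let $\rho_1$ and $\rho_2$ be irreducible representations of $\mathrm{SL}(2,\mathbb{Z}_p)$ and $\mathrm{SL}(2,\mathbb{Z}_q)$ of dimensions $\frac{p+1}{2}$ and $\frac{q+1}{2}$, respectively (of the form $\rho_{p,a_1}$, $\rho_{q,a_2}$ described in the context). If there is a modular fusion category $\mathcal{C}$ such that $\rho_{\mathcal{C}}\cong\rho_1\oplus\rho_2$, then $q-p=4$.
   Context: All fusion categories are over $\mathbb{C}$, and $\mathbb{Z}_n=\mathbb{Z}/n\mathbb{Z}$. A modular fusion category is a braided spherical fusion category $\mathcal{C}$ whose $S$-matrix $S_{X,Y}=\mathrm{Tr}(c_{Y,X}c_{X,Y})$ ($X,Y$ running over isomorphism classes of simple objects, $c$ the braiding) is non-degenerate; $T=(\delta_{X,Y}\theta_X)$ where $\theta$ is the ribbon structure; $\dim(\mathcal{C})=\sum_X\dim(X)\dim(X^* )$ is the global dimension. Modular representation: $\mathrm{SL}(2,\mathbb{Z})$ is generated by $\mathfrak{s}=\begin{pmatrix}0&1\\-1&0\end{pmatrix}$ and $\mathfrak{t}=\begin{pmatrix}1&1\\0&1\end{pmatrix}$. The assignment $\mathfrak{s}\mapsto\frac{1}{\sqrt{\dim(\mathcal{C})}}S$, $\mathfrak{t}\mapsto T$ is a projective representation of $\mathrm{SL}(2,\mathbb{Z})$, and $\rho_{\mathcal{C}}$ denotes a lift of it to a linear representation (so $\rho_{\mathcal{C}}(\mathfrak{s})$, $\rho_{\mathcal{C}}(\mathfrak{t})$ are scalar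 multiples of $S$ and $T$; such lifts factor through some $\mathrm{SL}(2,\mathbb{Z}_n)$). ''$\rho_{\mathcal{C}}\cong\rho$'' means that some such lift is isomorphic to $\rho$. Representations of $\mathrm{SL}(2,\mathbb{Z}_n)$ are viewed as representations of $\mathrm{SL}(2,\mathbb{Z})$ via reduction mod $n$. The $\frac{p+1}{2}$-dimensional irreducible representations: for an odd prime $p$ and an integer $a$ coprime to $p$, let $\beta_p=\left(\frac{a}{p}\right)\sqrt{\left(\frac{-1}{p}\right)\frac1p}$ (Legendre symbols, $\sqrt{-1}$ a fixed primitive 4th root of unity) and $\zeta_p=e^{2\pi i/p}$. With basis indexed by $0,1,\dots,\frac{p-1}{2}$, $\rho_{p,a}(\mathfrak{s})$ has $(0,0)$ entry $\beta_p$, $(0,j)$ and $(j,0)$ entries $\sqrt2\,\beta_p$, and $(j,k)$ entries $2\beta_p\cos\left(\frac{4\pi ajk}{p}\right)$ for $1\le j,k\le\frac{p-1}{2}$; and $\rho_{p,a}(\mathfrak{t})=\mathrm{diag}\left(1,\zeta_p^{a},\zeta_p^{4a},\dots,\zeta_p^{a(\frac{p-1}{2})^2}\right)$. Up to isomorphism there are exactly two such representations for given $p$, depending on $\left(\frac{a}{p}\right)$; these are the $\frac{p+1}{2}$-dimensional irreducible representations considered. *)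

(* Defs.v *)
From HB Require Import structures.
From mathcomp Require Import all_boot all_order all_algebra all_fingroup.
From mathcomp Require Import mxrepresentation complex.
From mathcomp Require Import all_classical all_reals all_analysis.

Set Implicit Arguments.
Unset Strict Implicit.
Unset Printing Implicit Defensive.

Import Order.TTheory GRing.Theory Num.Theory.
Local Open Scope ring_scope.

(** * Linear abelian categories *)

Record linearCategory (k : fieldType) := LinearCategory {
  ob :> Type;
  hom : ob -> ob -> vectType k;
  idm : forall X, hom X X;
  comp : forall X Y Z, hom Y Z -> hom X Y -> hom X Z;
  compA : forall W X Y Z (h : hom Y Z) (g : hom X Y) (f : hom W X),
    comp h (comp g f) = comp (comp h g) f;
  comp1m : forall X Y (f : hom X Y), comp (idm Y) f = f;
  compm1 : forall X Y (f : hom X Y), comp f (idm X) = f;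
  comp_linl : forall X Y Z (a : k) (g g' : hom Y Z) (f : hom X Y),
    comp (a *: g + g') f = a *: comp g f + comp g' f;
  comp_linr : forall X Y Z (a : k) (g : hom Y Z) (f f' : hom X Y),
    comp g (a *: f + f') = a *: comp g f + comp g f'
}.

Arguments hom {k C} X Y : rename.
Arguments idm {k C} X : rename.
Arguments comp {k C X Y Z} g f : rename.

Declare Scope cat_scope.
Delimit Scope cat_scope with cat.
Notation "g \oc f" := (comp g f) (at level 40, left associativity) : cat_scope.
Local Open Scope cat_scope.

Definition inverse_of (k : fieldType) (C : linearCategory k) (X Y : C)
  (f : hom X Y) (g : hom Y X) := g \oc f = idm X /\ f \oc g = idm Y.

Definition is_iso (k : fieldType) (C : linearCategory k) (X Y : C)
  (f : hom X Y) := exists g : hom Y X, inverse_of f g.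

Definition isomorphic (k : fieldType) (C : linearCategory k) (X Y : C) :=
  exists f : hom X Y, is_iso f.

Definition is_mono (k : fieldType) (C : linearCategory k) (X Y : C)
  (f : hom X Y) := forall (W : C) (g h : hom W X), f \oc g = f \oc h -> g = h.

Definition is_epi (k : fieldType) (C : linearCategory k) (X Y : C)
  (f : hom X Y) := forall (Z : C) (g h : hom Y Z), g \oc f = h \oc f -> g = h.

Definition is_kernel (k : fieldType) (C : linearCategory k) (K X Y : C)
    (i : hom K X) (f : hom X Y) :=
  f \oc i = 0 /\
  forall (W : C) (g : hom W X), f \oc g = 0 -> exists! h : hom W K, i \oc h = g.

Definition is_cokernel (k : fieldType) (C : linearCategory k) (X Y Q : C)
    (r : hom Y Q) (f : hom X Y) :=
  r \oc f = 0 /\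
  forall (Z : C) (g : hom Y Z), g \oc f = 0 -> exists! h : hom Q Z, h \oc r = g.

Definition is_zero (k : fieldType) (C : linearCategory k) (X : C) :=
  idm X = 0.

Definition is_direct_sum (k : fieldType) (C : linearCategory k)
    (n : nat) (Y : 'I_n -> C) (X : C) :=
  exists (i : forall j, hom (Y j) X) (r : forall j, hom X (Y j)),
    [/\ forall j, r j \oc i j = idm (Y j),
        forall j l, j != l -> r j \oc i l = 0
      & \sum_(j < n) (i j \oc r j) = idm X].

Record abelian_category (k : fieldType) (C : linearCategory k) : Prop := {
  abelian_sum : forall (n : nat) (Y : 'I_n -> C),
    exists X : C, is_direct_sum Y X;
  abelian_ker : forall (X Y : C) (f : hom X Y),
    exists (K : C) (i : hom K X), is_kernel i f;
  abelian_coker : forall (X Y : C) (f : hom X Y),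
    exists (Q : C) (r : hom Y Q), is_cokernel r f;
  abelian_mono : forall (X Y : C) (f : hom X Y), is_mono f ->
    exists (Z : C) (g : hom Y Z), is_kernel f g;
  abelian_epi : forall (X Y : C) (f : hom X Y), is_epi f ->
    exists (W : C) (g : hom W X), is_cokernel f g
}.

Definition simple_ob (k : fieldType) (C : linearCategory k) (X : C) :=
  ~ is_zero X /\
  forall (Y : C) (f : hom Y X), is_mono f -> is_zero Y \/ is_iso f.

Definition semisimple_category (k : fieldType) (C : linearCategory k) :=
  forall X : C, exists (n : nat) (Y : 'I_n -> C),
    (forall j, simple_ob (Y j)) /\ is_direct_sum Y X.

(* If X is simple then End(X) = k.id over an algebraically closed k, and
   [scalar_of f] is the c such that f = c.id. *)
Definition scalar_of (k : fieldType) (C : linearCategory k) (X : C)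
  (f : hom X X) : k := xget 0 [set c : k | f = c *: idm X]%classic.

(** * Monoidal structures *)

Record monoidal (k : fieldType) (C : linearCategory k) := Monoidal {
  tens : C -> C -> C;
  tensm : forall X X' Y Y' : C,
    hom X X' -> hom Y Y' -> hom (tens X Y) (tens X' Y');
  unit_ob : C;
  assoc : forall X Y Z : C, hom (tens (tens X Y) Z) (tens X (tens Y Z));
  assocV : forall X Y Z : C, hom (tens X (tens Y Z)) (tens (tens X Y) Z);
  lunit : forall X : C, hom (tens unit_ob X) X;
  lunitV : forall X : C, hom X (tens unit_ob X);
  runit : forall X : C, hom (tens X unit_ob) X;
  runitV : forall X : C, hom X (tens X unit_ob);
  tensm1 : forall X Y : C, tensm (idm X) (idm Y) = idm (tens X Y);
  tensm_comp : forall (X X' X'' Y Y' Y'' : C) (f' : hom X' X'') (f : hom X X')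
      (g' : hom Y' Y'') (g : hom Y Y'),
    tensm (f' \oc f) (g' \oc g) = tensm f' g' \oc tensm f g;
  tensm_linl : forall (X X' Y Y' : C) (a : k) (f f' : hom X X') (g : hom Y Y'),
    tensm (a *: f + f') g = a *: tensm f g + tensm f' g;
  tensm_linr : forall (X X' Y Y' : C) (a : k) (f : hom X X') (g g' : hom Y Y'),
    tensm f (a *: g + g') = a *: tensm f g + tensm f g';
  assoc_inv : forall X Y Z, inverse_of (assoc X Y Z) (assocV X Y Z);
  lunit_inv : forall X, inverse_of (lunit X) (lunitV X);
  runit_inv : forall X, inverse_of (runit X) (runitV X);
  assoc_nat : forall (X X' Y Y' Z Z' : C)
      (f : hom X X') (g : hom Y Y') (h : hom Z Z'),
    assoc X' Y' Z' \oc tensm (tensm f g) h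
      = tensm f (tensm g h) \oc assoc X Y Z;
  lunit_nat : forall (X X' : C) (f : hom X X'),
    lunit X' \oc tensm (idm unit_ob) f = f \oc lunit X;
  runit_nat : forall (X X' : C) (f : hom X X'),
    runit X' \oc tensm f (idm unit_ob) = f \oc runit X;
  pentagon : forall W X Y Z : C,
    assoc W X (tens Y Z) \oc assoc (tens W X) Y Z
      = tensm (idm W) (assoc X Y Z) \oc assoc W (tens X Y) Z
          \oc tensm (assoc W X Y) (idm Z);
  triangle : forall X Y : C,
    tensm (idm X) (lunit Y) \oc assoc X unit_ob Y = tensm (runit X) (idm Y)
}.

Arguments tens {k C} m X Y : rename.
Arguments tensm {k C} m {X X' Y Y'} f g : rename.
Arguments unit_ob {k C} m : rename.
Arguments assoc {k C} m X Y Z : rename.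
Arguments assocV {k C} m X Y Z : rename.
Arguments lunit {k C} m X : rename.
Arguments lunitV {k C} m X : rename.
Arguments runit {k C} m X : rename.
Arguments runitV {k C} m X : rename.

Record braiding (k : fieldType) (C : linearCategory k) (M : monoidal C) :=
Braiding {
  braid : forall X Y : C, hom (tens M X Y) (tens M Y X);
  braid_iso : forall X Y, is_iso (braid X Y);
  braid_nat : forall (X X' Y Y' : C) (f : hom X X') (g : hom Y Y'),
    braid X' Y' \oc tensm M f g = tensm M g f \oc braid X Y;
  hexagon_l : forall X Y Z : C,
    assoc M Y Z X \oc braid X (tens M Y Z) \oc assoc M X Y Z
      = tensm M (idm Y) (braid X Z) \oc assoc M Y X Z
          \oc tensm M (braid X Y) (idm Z);
  hexagon_r : forall X Y Z : C,
    assocV M Z X Y \oc braid (tens M X Y) Z \oc assocV M X Y Z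
      = tensm M (braid X Z) (idm Y) \oc assocV M X Z Y
          \oc tensm M (idm X) (braid Y Z)
}.

Arguments braid {k C M} b X Y : rename.

(** * Duals, pivotal structures, traces *)

(* [X'] is a left dual of [X] (equivalently [X] is a right dual of [X']). *)
Definition dual_pair (k : fieldType) (C : linearCategory k) (M : monoidal C)
    (X X' : C) (ev : hom (tens M X' X) (unit_ob M))
    (coev : hom (unit_ob M) (tens M X X')) :=
  runit M X \oc tensm M (idm X) ev \oc assoc M X X' X
    \oc tensm M coev (idm X) \oc lunitV M X = idm X /\
  lunit M X' \oc tensm M ev (idm X') \oc assocV M X' X X'
    \oc tensm M (idm X') coev \oc runitV M X' = idm X'.

Record rigid (k : fieldType) (C : linearCategory k) (M : monoidal C) :=
Rigid {
  ldual : C -> C;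
  ev : forall X, hom (tens M (ldual X) X) (unit_ob M);
  coev : forall X, hom (unit_ob M) (tens M X (ldual X));
  dualP : forall X, dual_pair (ev X) (coev X);
  right_dual : forall X : C, exists (Y : C)
    (e : hom (tens M X Y) (unit_ob M)) (c : hom (unit_ob M) (tens M Y X)),
    dual_pair e c
}.

Arguments ldual {k C M} D X : rename.
Arguments ev {k C M} D X : rename.
Arguments coev {k C M} D X : rename.

(* The morphism A -> X^* corresponding to a pairing A (x) X -> 1. *)
Definition curry (k : fieldType) (C : linearCategory k) (M : monoidal C)
    (D : rigid M) (A X : C) (e : hom (tens M A X) (unit_ob M)) :
    hom A (ldual D X) :=
  lunit M (ldual D X) \oc tensm M e (idm (ldual D X))
    \oc assocV M A X (ldual D X) \oc tensm M (idm A) (coev D X) \oc runitV M A.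

Definition dualm (k : fieldType) (C : linearCategory k) (M : monoidal C)
    (D : rigid M) (X Y : C) (f : hom X Y) : hom (ldual D Y) (ldual D X) :=
  curry D (ev D Y \oc tensm M (idm (ldual D Y)) f).

(* The canonical isomorphism Y^* (x) X^* -> (X (x) Y)^*. *)
Definition dual_tens (k : fieldType) (C : linearCategory k) (M : monoidal C)
    (D : rigid M) (X Y : C) :
    hom (tens M (ldual D Y) (ldual D X)) (ldual D (tens M X Y)) :=
  curry D (ev D Y
    \oc tensm M (idm (ldual D Y))
          (lunit M Y \oc tensm M (ev D X) (idm Y) \oc assocV M (ldual D X) X Y)
    \oc assoc M (ldual D Y) (ldual D X) (tens M X Y)).

(* [piv_tens] says that X -> X^** is monoidal, the tensor structure of X |-> X^**
   being (dual_tens X Y)^*^-1 o dual_tens Y^* X^*. *)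
Record pivotal (k : fieldType) (C : linearCategory k) (M : monoidal C)
  (D : rigid M) := Pivotal {
  piv : forall X : C, hom X (ldual D (ldual D X));
  pivV : forall X : C, hom (ldual D (ldual D X)) X;
  piv_inv : forall X, inverse_of (piv X) (pivV X);
  piv_nat : forall (X Y : C) (f : hom X Y),
    piv Y \oc f = dualm D (dualm D f) \oc piv X;
  piv_tens : forall X Y : C,
    dualm D (dual_tens D X Y) \oc piv (tens M X Y)
      = dual_tens D (ldual D Y) (ldual D X) \oc tensm M (piv X) (piv Y)
}.

Arguments piv {k C M D} p X : rename.
Arguments pivV {k C M D} p X : rename.

Definition ltrace (k : fieldType) (C : linearCategory k) (M : monoidal C)
    (D : rigid M) (P : pivotal D) (X : C) (f : hom X X) :
    hom (unit_ob M) (unit_ob M) :=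
  ev D (ldual D X) \oc tensm M (piv P X \oc f) (idm (ldual D X)) \oc coev D X.

Definition rtrace (k : fieldType) (C : linearCategory k) (M : monoidal C)
    (D : rigid M) (P : pivotal D) (X : C) (f : hom X X) :
    hom (unit_ob M) (unit_ob M) :=
  ev D X \oc tensm M (idm (ldual D X)) (f \oc pivV P X) \oc coev D (ldual D X).

Definition spherical (k : fieldType) (C : linearCategory k) (M : monoidal C)
    (D : rigid M) (P : pivotal D) :=
  forall (X : C) (f : hom X X), ltrace P f = rtrace P f.

(* The Drinfeld morphism u_X : X -> X (x) X^* (x) X^** -> X^* (x) X (x) X^**
   -> X^**. *)
Definition drinfeld (k : fieldType) (C : linearCategory k) (M : monoidal C)
    (D : rigid M) (B : braiding M) (X : C) : hom X (ldual D (ldual D X)) :=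
  let X' := ldual D X in let X'' := ldual D X' in
  lunit M X'' \oc tensm M (ev D X) (idm X'')
    \oc tensm M (braid B X X') (idm X'')
    \oc assocV M X X' X'' \oc tensm M (idm X) (coev D X') \oc runitV M X.

(** * Braided spherical and modular fusion categories *)

(* [simple_rep] enumerates the isomorphism classes of simple objects. *)
Record braidedSphericalFusion (k : fieldType) := BraidedSphericalFusion {
  bsf_cat :> linearCategory k;
  bsf_abelian : abelian_category bsf_cat;
  bsf_semisimple : semisimple_category bsf_cat;
  bsf_mon : monoidal bsf_cat;
  bsf_unit : simple_ob (unit_ob bsf_mon);
  bsf_rigid : rigid bsf_mon;
  num_simple : nat;
  simple_rep : 'I_num_simple -> bsf_cat;
  simple_repP : forall i, simple_ob (simple_rep i);
  simple_rep_uniq : forall X : bsf_cat, simple_ob X ->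
    exists! i, isomorphic X (simple_rep i);
  bsf_piv : pivotal bsf_rigid;
  bsf_spherical : spherical bsf_piv;
  bsf_braid : braiding bsf_mon
}.

Arguments simple_rep {k} C i : rename.

Definition Tr (k : fieldType) (C : braidedSphericalFusion k) (X : C)
  (f : hom X X) : k := scalar_of (ltrace (bsf_piv C) f).

(* The ribbon structure theta attached to the braiding and the spherical
   structure is determined by piv = u o theta; for simple X, theta_X is a
   scalar. *)
Definition twist (k : fieldType) (C : braidedSphericalFusion k) (X : C) : k :=
  xget 0 [set c : k | drinfeld (bsf_rigid C) (bsf_braid C) X \oc (c *: idm X)
                      = piv (bsf_piv C) X]%classic.

Definition Smatrix (k : fieldType) (C : braidedSphericalFusion k) :
    'M[k]_(num_simple C) :=
  \matrix_(i, j) Tr (braid (bsf_braid C) (simple_rep C j) (simple_rep C i)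
                     \oc braid (bsf_braid C) (simple_rep C i) (simple_rep C j)).

Definition Tmatrix (k : fieldType) (C : braidedSphericalFusion k) :
    'M[k]_(num_simple C) :=
  diag_mx (\row_i twist (simple_rep C i)).

Record modularFusion (k : fieldType) := ModularFusion {
  mod_bsf :> braidedSphericalFusion k;
  mod_nondeg : Smatrix mod_bsf \in unitmx
}.

(** * SL(2,Z), SL(2,Z_n) and their representations *)

Definition mx2 (A : Type) (a b c d : A) : 'M[A]_2 :=
  \matrix_(i, j) if i == ord0 then if j == ord0 then a else b
                 else if j == ord0 then c else d.

Definition sl2s : 'M[int]_2 := mx2 0 1 (-1) 0.
Definition sl2t : 'M[int]_2 := mx2 1 1 0 1.

(* 'Z_n, hence SL2Zn n, is the intended object only for n > 1. *)
Definition SL2Zn (n : nat) : {set {'GL_2['Z_n]}} := [set g | \det (GLval g) == 1].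

Lemma SL2Zn_group_set (n : nat) : group_set (SL2Zn n).
Proof.
apply/group_setP; split=> [|g h]; first by rewrite inE GL_1E det1.
by rewrite !inE GL_MxE det_mulmx => /eqP-> /eqP->; rewrite mulr1.
Qed.

Canonical SL2Zn_group (n : nat) := Group (SL2Zn_group_set n).

Definition SL2Z : {pred 'M[int]_2} := [pred M | \det M == 1].

(* Reduction mod n, meaningful on SL2Z. *)
Definition redSL2 (n : nat) (M : 'M[int]_2) : {'GL_2['Z_n]} :=
  insubd (1%g : {'GL_2['Z_n]}) (map_mx (fun z : int => z%:~R : 'Z_n) M).

(* Representations of SL(2,Z), with the same shape as [mx_repr]; the values
   outside SL2Z are irrelevant. *)
Definition SL2Z_repr (k : fieldType) (n : nat) (rho : 'M[int]_2 -> 'M[k]_n) :=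
  rho 1%:M = 1%:M /\ {in SL2Z &, {morph rho : M N / M *m N}}.

Definition SL2Z_iso (k : fieldType) (n m : nat)
    (rho : 'M[int]_2 -> 'M[k]_n) (rho' : 'M[int]_2 -> 'M[k]_m) :=
  exists P : 'M[k]_(n, m), [/\ n = m, row_free P
    & {in SL2Z, forall M, rho M *m P = P *m rho' M}].

Definition inflate (k : fieldType) (n d : nat)
    (rho : mx_representation k (SL2Zn n) d) : 'M[int]_2 -> 'M[k]_d :=
  fun M => rho (redSL2 n M).

Definition dsum (k : fieldType) (n m : nat)
    (rho : 'M[int]_2 -> 'M[k]_n) (rho' : 'M[int]_2 -> 'M[k]_m) :
    'M[int]_2 -> 'M[k]_(n + m) :=
  fun M => block_mx (rho M) 0 0 (rho' M).

Definition modular_lift (k : fieldType) (C : modularFusion k)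
    (rho : 'M[int]_2 -> 'M[k]_(num_simple C)) :=
  [/\ SL2Z_repr rho, exists x : k, rho sl2s = x *: Smatrix C
    & exists y : k, rho sl2t = y *: Tmatrix C].

Definition modular_rep_iso (k : fieldType) (C : modularFusion k) (n : nat)
    (rho : 'M[int]_2 -> 'M[k]_n) :=
  exists2 rhoC : 'M[int]_2 -> 'M[k]_(num_simple C),
    modular_lift rhoC & SL2Z_iso rhoC rho.

(** * The (p+1)/2-dimensional representations *)

Definition legendre (p : nat) (a : int) : int :=
  if a%:~R == 0 :> 'Z_p then 0
  else if [exists x : 'Z_p, x ^+ 2 == a%:~R] then 1 else -1.

Definition zeta (R : realType) (p : nat) : R[i] :=
  Complex (cos (2 * pi / p%:R)) (sin (2 * pi / p%:R)).

(* For p = 3 mod 4, [sqrtC] picks the root i / sqrt p, with positive imaginary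
   part; this is the choice of the square root of -1 matching [zeta]. *)
Definition rho_beta (R : realType) (p : nat) (a : int) : R[i] :=
  (legendre p a)%:~R * sqrtC ((legendre p (-1))%:~R / p%:R).

Definition rho_s (R : realType) (p : nat) (a : int) : 'M[R[i]]_(p.+1./2) :=
  \matrix_(j, l)
    if (j == 0 :> nat) && (l == 0 :> nat) then rho_beta R p a
    else if (j == 0 :> nat) || (l == 0 :> nat) then sqrtC 2 * rho_beta R p a
    else 2 * rho_beta R p a *
      (real_complex R (cos (4 * pi * a%:~R * j%:R * l%:R / p%:R))).

Definition rho_t (R : realType) (p : nat) (a : int) : 'M[R[i]]_(p.+1./2) :=
  diag_mx (\row_j (zeta R p ^ (a * (j%:Z ^+ 2)))).

(* [rho] is isomorphic to rho_{p,a}; the images of s and t generate. *)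
Definition is_rho (R : realType) (p : nat) (a : int)
    (rho : mx_representation R[i] (SL2Zn p) p.+1./2) :=
  exists2 P : 'M[R[i]]_(p.+1./2), P \in unitmx &
    inflate rho sl2s *m P = P *m rho_s R p a /\
    inflate rho sl2t *m P = P *m rho_t R p a.

(* Main.v *)
Require Import Defs.
From HB Require Import structures.
From mathcomp Require Import all_boot all_order all_algebra all_fingroup.
From mathcomp Require Import mxrepresentation complex.
From mathcomp Require Import all_classical all_reals all_analysis.
From mathcomp Require Import all_field.
From mathcomp Require Import ring zify.
Import Defs VectorInternalTheory.

Set Implicit Arguments.
Unset Strict Implicit.
Unset Printing Implicit Defensive.

Import Order.TTheory GRing.Theory Num.Theory.
Local Open Scope ring_scope.

(**
The eigenvalue 1 of [rho t] is shared by [rho_1] and [rho_2] and all other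
eigenvalues are simple, so in the basis of simple objects the S-matrix is the
block matrix conjugated by signs and by a 2x2 matrix acting on the two basis
vectors of eigenvalue 1. By Schur's lemma and the symmetry of S the latter can
be taken orthogonal, i.e. [[u, v], [-v, u]] up to a sign. The unit is one of
these two objects because its S-row has no zero; let B be the other one. By the
Verlinde relations the integral fusion matrix of B has the eigenvalues S_Bk /
S_1k, which are -v/u on the (p-1)/2 simple objects of [rho_1] and kappa = u/v on
the (q-1)/2 simple objects of [rho_2], plus two more.
- If kappa is irrational, its minimal polynomial has degree at least 2 and
  divides the characteristic polynomial (q-1)/2 times, whence q - p <= 4.
- If kappa is rational, kappa and -1/kappa are integers, so u^2 = v^2, and
  integrality of the trace gives 2(p+q)/(q-p) in Z, whence q - p divides 4.
Finally S^2 is (-1/p) on [rho_1] and (-1/q) on [rho_2]; were these signs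
different, (S^2)_ij = sum_m N_ij^m (S^2)_1m would force kappa to be rational
and then N_ij^m to be negative. So p = q mod 4.

The only input from category theory is the Verlinde relation
S_ik S_jk = S_1k sum_m N_ij^m S_mk with N_ij^m natural numbers. It is proved
with string diagrams read as natural families of morphisms between the objects
X (x) (Y (x) ( ... (x) A)), where associators disappear.
*)

(** * Graphical calculus in a braided pivotal category *)

Local Open Scope cat_scope.

Section Composition.
Variables (k : fieldType) (C : linearCategory k).
Implicit Types V W X Y Z : C.

(** Composites are kept right-nested, so an equation [g \oc f = h] must also rewrite when a further
    factor follows [f]; this produces that rule. *)
Lemma reassoc W X Y (g : hom X Y) (f : hom W X) (h : hom W Y) :
  g \oc f = h -> forall V (m : hom V W), g \oc (f \oc m) = h \oc m.
Proof. by move=> <- V m; rewrite compA. Qed.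

Lemma reassoc3 V W X Y (g : hom X Y) (f : hom W X) (e : hom V W)
    (h : hom V Y) :
  g \oc (f \oc e) = h ->
  forall U (m : hom U V), g \oc (f \oc (e \oc m)) = h \oc m.
Proof. by move=> <- U m; rewrite !compA. Qed.

Lemma comp0m X Y Z (f : hom X Y) : (0 : hom Y Z) \oc f = 0.
Proof. by rewrite -[0](addNr 0) -scaleN1r comp_linl scaleN1r addNr. Qed.

Lemma compm0 X Y Z (f : hom Y Z) : f \oc (0 : hom X Y) = 0.
Proof. by rewrite -[0](addNr 0) -scaleN1r comp_linr scaleN1r addNr. Qed.

Lemma compDl X Y Z (g g' : hom Y Z) (f : hom X Y) :
  (g + g') \oc f = g \oc f + g' \oc f.
Proof. by rewrite -[g]scale1r comp_linl !scale1r. Qed.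

Lemma compDr X Y Z (g : hom Y Z) (f f' : hom X Y) :
  g \oc (f + f') = g \oc f + g \oc f'.
Proof. by rewrite -[f]scale1r comp_linr !scale1r. Qed.

Lemma compZl X Y Z a (g : hom Y Z) (f : hom X Y) :
  (a *: g) \oc f = a *: (g \oc f).
Proof. by rewrite -[a *: g]addr0 comp_linl comp0m addr0. Qed.

Lemma compZr X Y Z a (g : hom Y Z) (f : hom X Y) :
  g \oc (a *: f) = a *: (g \oc f).
Proof. by rewrite -[a *: f]addr0 comp_linr compm0 addr0. Qed.

Lemma comp_suml X Y Z n (g : 'I_n -> hom Y Z) (f : hom X Y) :
  (\sum_i g i) \oc f = \sum_i (g i \oc f).
Proof.
by apply: (big_ind2 (fun a b => a \oc f = b)) => [|a b c d <- <-|//];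
  rewrite ?comp0m ?compDl.
Qed.

Lemma comp_sumr X Y Z n (g : hom Y Z) (f : 'I_n -> hom X Y) :
  g \oc (\sum_i f i) = \sum_i (g \oc f i).
Proof.
by apply: (big_ind2 (fun a b => g \oc a = b)) => [|a b c d <- <-|//];
  rewrite ?compm0 ?compDr.
Qed.

End Composition.

Arguments reassoc {k C W X Y g f h} _ V m.
Arguments reassoc3 {k C V W X Y g f e h} _ U m.

(** * Whiskering, coherence, and diagrams acting on a spectator object *)

Section Whiskering.
Variables (k : fieldType) (C : linearCategory k) (M : monoidal C).
Implicit Types A B W X Y Z : C.

Local Notation "X \tx Y" := (tens M X Y) (at level 35, right associativity).
Local Notation "1" := (unit_ob M).

Definition lw X A B (g : hom A B) : hom (X \tx A) (X \tx B) :=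
  tensm M (idm X) g.
Definition rw X Y (f : hom X Y) A : hom (X \tx A) (Y \tx A) :=
  tensm M f (idm A).

Local Notation "X \lw g" := (lw X g) (at level 30, right associativity).
Local Notation "f \rw A" := (rw f A) (at level 28, left associativity).
Local Notation al := (assoc M).
Local Notation alV := (assocV M).
Local Notation la := (lunit M).
Local Notation laV := (lunitV M).
Local Notation ro := (runit M).
Local Notation roV := (runitV M).

Lemma lw1 X A : X \lw idm A = idm (X \tx A).
Proof. exact: tensm1. Qed.

Lemma rw1 X A : idm X \rw A = idm (X \tx A).
Proof. exact: tensm1. Qed.

Lemma lwM X A B D (g : hom B D) (f : hom A B) :
  X \lw (g \oc f) = (X \lw g) \oc (X \lw f).
Proof. by rewrite /lw -tensm_comp comp1m. Qed.

Lemma rwM A X Y Z (g : hom Y Z) (f : hom X Y) :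
  (g \oc f) \rw A = (g \rw A) \oc (f \rw A).
Proof. by rewrite /rw -tensm_comp comp1m. Qed.

Lemma rwlw A B X Y (f : hom X Y) (g : hom A B) :
  (f \rw B) \oc (X \lw g) = (Y \lw g) \oc (f \rw A).
Proof. by rewrite /rw /lw -!tensm_comp !comp1m !compm1. Qed.

Lemma lwZ X A B a (g : hom A B) : X \lw (a *: g) = a *: (X \lw g).
Proof.
rewrite /lw -[a *: g]addr0 tensm_linr.
suff -> : tensm M (idm X) (0 : hom A B) = 0 by rewrite addr0.
by rewrite -[X in tensm _ _ X](addNr 0) -scaleN1r tensm_linr scaleN1r addNr.
Qed.

Lemma rwZ X Y A a (f : hom X Y) : (a *: f) \rw A = a *: (f \rw A).
Proof.
rewrite /rw -[a *: f]addr0 tensm_linl.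
suff -> : tensm M (0 : hom X Y) (idm A) = 0 by rewrite addr0.
by rewrite -[X in tensm _ X _](addNr 0) -scaleN1r tensm_linl scaleN1r addNr.
Qed.

Lemma rwD X Y A (f g : hom X Y) : (f + g) \rw A = f \rw A + g \rw A.
Proof. by rewrite /rw -[f]scale1r tensm_linl !scale1r. Qed.

Lemma lwD X A B (f g : hom A B) : X \lw (f + g) = X \lw f + X \lw g.
Proof. by rewrite /lw -[f]scale1r tensm_linr !scale1r. Qed.

Lemma lw_sum X A B n (f : 'I_n -> hom A B) :
  X \lw (\sum_i f i) = \sum_i (X \lw f i).
Proof.
apply: (big_ind2 (fun a b => X \lw a = b)) => [|a b c d <- <-|//].
  by rewrite -(scale0r 0) lwZ scale0r.
exact: lwD.
Qed.

Lemma rw_sum X Y A n (f : 'I_n -> hom X Y) :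
  (\sum_i f i) \rw A = \sum_i (f i \rw A).
Proof.
apply: (big_ind2 (fun a b => a \rw A = b)) => [|a b c d <- <-|//].
  by rewrite -(scale0r 0) rwZ scale0r.
exact: rwD.
Qed.

Lemma alK X Y Z : alV X Y Z \oc al X Y Z = idm _.
Proof. by case: (assoc_inv M X Y Z). Qed.
Lemma alVK X Y Z : al X Y Z \oc alV X Y Z = idm _.
Proof. by case: (assoc_inv M X Y Z). Qed.
Lemma laK X : laV X \oc la X = idm _.
Proof. by case: (lunit_inv M X). Qed.
Lemma laVK X : la X \oc laV X = idm _.
Proof. by case: (lunit_inv M X). Qed.
Lemma roK X : roV X \oc ro X = idm _.
Proof. by case: (runit_inv M X). Qed.
Lemma roVK X : ro X \oc roV X = idm _.
Proof. by case: (runit_inv M X). Qed.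

Lemma al_rw X X' Y Z (f : hom X X') :
  al X' Y Z \oc (f \rw Y \rw Z) = (f \rw (Y \tx Z)) \oc al X Y Z.
Proof. by rewrite /rw assoc_nat tensm1. Qed.

Lemma al_mid X Y Y' Z (f : hom Y Y') :
  al X Y' Z \oc ((X \lw f) \rw Z) = (X \lw (f \rw Z)) \oc al X Y Z.
Proof. by rewrite /rw /lw assoc_nat. Qed.

Lemma al_lw X Y Z Z' (f : hom Z Z') :
  al X Y Z' \oc ((X \tx Y) \lw f) = (X \lw (Y \lw f)) \oc al X Y Z.
Proof. by rewrite /lw -assoc_nat tensm1. Qed.

Lemma alV_rw X X' Y Z (f : hom X X') :
  alV X' Y Z \oc (f \rw (Y \tx Z)) = (f \rw Y \rw Z) \oc alV X Y Z.
Proof.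
rewrite -[LHS]compm1 -(alVK X Y Z) -!compA (reassoc (esym (al_rw _ _ f))).
by rewrite -compA (reassoc (alK _ _ _)) comp1m.
Qed.

Lemma alV_mid X Y Y' Z (f : hom Y Y') :
  alV X Y' Z \oc (X \lw (f \rw Z)) = ((X \lw f) \rw Z) \oc alV X Y Z.
Proof.
rewrite -[LHS]compm1 -(alVK X Y Z) -!compA (reassoc (esym (al_mid _ _ f))).
by rewrite -compA (reassoc (alK _ _ _)) comp1m.
Qed.

Lemma alV_lw X Y Z Z' (f : hom Z Z') :
  alV X Y Z' \oc (X \lw (Y \lw f)) = ((X \tx Y) \lw f) \oc alV X Y Z.
Proof.
rewrite -[LHS]compm1 -(alVK X Y Z) -!compA (reassoc (esym (al_lw _ _ f))).
by rewrite -compA (reassoc (alK _ _ _)) comp1m.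
Qed.

Lemma la_nat A B (f : hom A B) : la B \oc (1 \lw f) = f \oc la A.
Proof. exact: lunit_nat. Qed.

Lemma laV_nat A B (f : hom A B) : laV B \oc f = (1 \lw f) \oc laV A.
Proof.
rewrite -[LHS]compm1 -(laVK A) -!compA (reassoc (esym (la_nat f))).
by rewrite -compA (reassoc (laK _)) comp1m.
Qed.

Lemma pent W X Y Z :
  al W X (Y \tx Z) \oc al (W \tx X) Y Z =
  (W \lw al X Y Z) \oc (al W (X \tx Y) Z \oc (al W X Y \rw Z)).
Proof. by rewrite pentagon compA. Qed.

(** This and the next three lemmas are the pentagon with some edges inverted, in the orientations
    that arise when diagrams are pushed through associators. *)
Lemma pent_lwV W X Y Z :
  (W \lw alV X Y Z) \oc (al W X (Y \tx Z) \oc al (W \tx X) Y Z) =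
  al W (X \tx Y) Z \oc (al W X Y \rw Z).
Proof. by rewrite pent compA -lwM alK lw1 comp1m. Qed.

Lemma pent_V W X Y Z :
  alV W X (Y \tx Z) \oc ((W \lw al X Y Z) \oc al W (X \tx Y) Z) =
  al (W \tx X) Y Z \oc (alV W X Y \rw Z).
Proof.
rewrite -[RHS]comp1m -(alK W X) -!compA (reassoc (pent _ _ _ _)).
by rewrite -!compA -rwM alVK rw1 compm1.
Qed.

Lemma pent_VV W X Y Z :
  alV W X (Y \tx Z) \oc (W \lw al X Y Z) =
  al (W \tx X) Y Z \oc ((alV W X Y \rw Z) \oc alV W (X \tx Y) Z).
Proof. by rewrite [RHS]compA -pent_V -!compA alVK compm1. Qed.

Lemma pent_lwVV W X Y Z :
  (W \lw alV X Y Z) \oc al W X (Y \tx Z) =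
  al W (X \tx Y) Z \oc ((al W X Y \rw Z) \oc alV (W \tx X) Y Z).
Proof. by rewrite [RHS]compA -pent_lwV -!compA alVK compm1. Qed.

Lemma tri X A : (X \lw la A) \oc al X 1 A = ro X \rw A.
Proof. exact: triangle. Qed.

Lemma triV X A : alV X 1 A \oc (X \lw laV A) = roV X \rw A.
Proof.
rewrite -[LHS]comp1m -rw1 -(roK X) rwM -tri -!compA.
by rewrite (reassoc (alVK _ _ _)) comp1m -lwM laVK lw1 compm1.
Qed.

Lemma lw_unit_inj A B (f g : hom A B) : 1 \lw f = 1 \lw g -> f = g.
Proof.
move=> e; rewrite -[f]compm1 -[g]compm1 -(laVK A) !compA -!la_nat.
by rewrite e.
Qed.

(* Kelly's coherence lemma: it need only be checked after the faithful functor
   1 (x) -, where it follows from the pentagon and the triangle. *)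
Lemma la_al X Y : la (X \tx Y) \oc al 1 X Y = la X \rw Y.
Proof.
apply: lw_unit_inj; rewrite lwM.
rewrite -[LHS]compm1 -[RHS]compm1 -(alVK 1 (1 \tx X) Y) !compA.
congr (_ \oc _); rewrite -al_mid -!compA.
rewrite -[RHS]compm1 -[LHS]compm1 -rw1 -(alVK 1 1 X) rwM !compA.
congr (_ \oc _); rewrite -!compA -pent (reassoc (tri _ _)).
by rewrite -al_rw -rwM tri.
Qed.

Lemma al_laV X Y : al 1 X Y \oc (laV X \rw Y) = laV (X \tx Y).
Proof.
rewrite -[LHS]comp1m -laK -compA (reassoc (la_al _ _)) -rwM laVK rw1.
by rewrite compm1.
Qed.

(** A pairing encoded as a family natural in a spectator [B] on the right, with the associator
    absorbed; [copair] does the same for a copairing. *)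
Definition pair A X (e : hom (A \tx X) 1) B : hom (A \tx (X \tx B)) B :=
  la B \oc ((e \rw B) \oc alV A X B).

Definition copair X A (c : hom 1 (X \tx A)) B : hom B (X \tx (A \tx B)) :=
  al X A B \oc ((c \rw B) \oc laV B).

Lemma pair_nat A X (e : hom (A \tx X) 1) B B' (g : hom B B') :
  pair e B' \oc (A \lw (X \lw g)) = g \oc pair e B.
Proof.
rewrite /pair -!compA alV_lw (reassoc (rwlw _ _)) -compA.
by rewrite (reassoc (la_nat _)) -compA.
Qed.

Lemma copair_nat A X (c : hom 1 (X \tx A)) B B' (g : hom B B') :
  copair c B' \oc g = (X \lw (A \lw g)) \oc copair c B.
Proof.
rewrite /copair -!compA laV_nat (reassoc (rwlw _ _)) -compA.
by rewrite (reassoc (al_lw _ _ _)) -compA.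
Qed.

Lemma pair_lw_rw A X X' (e : hom (A \tx X') 1) (f : hom X X') B :
  pair (e \oc (A \lw f)) B = pair e B \oc (A \lw (f \rw B)).
Proof. by rewrite /pair -!compA alV_mid rwM -!compA. Qed.

Lemma pair_tens A X (e : hom (A \tx X) 1) Y B :
  (pair e Y \rw B) \oc alV A (X \tx Y) B = pair e (Y \tx B) \oc (A \lw al X Y B).
Proof.
rewrite /pair -!compA !rwM -!compA -la_al -!compA.
by rewrite pent_VV (reassoc (al_rw _ _ _)) -compA.
Qed.

(** The hypothesis is the first duality equation; tensoring it with [B] and moving associators by
    pentagon and triangle turns it into a snake identity between families. *)
Lemma pair_copair A X (e : hom (A \tx X) 1) (c : hom 1 (X \tx A)) B :
  ro X \oc tensm M (idm X) e \oc al X A X \oc tensm M c (idm X) \oc laV X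
    = idm X ->
  (X \lw pair e B) \oc copair c (X \tx B) = idm (X \tx B).
Proof.
move=> z; rewrite -(rw1 X) -z !rwM -!compA -tri -!compA -/(lw X e) -/(rw c X).
rewrite (reassoc (al_mid _ _ _)) -compA.
rewrite (reassoc (esym (pent_lwV _ _ _ _))) -!compA.
rewrite (reassoc (al_rw _ _ _)) -!compA al_laV.
by rewrite /pair /copair !lwM -!compA.
Qed.

(** * Cups, caps and mates in the pivotal calculus *)

Section Duality.
Variables (D : rigid M) (P : pivotal D).
Local Notation "X ^v" := (ldual D X) (at level 2, format "X ^v").

(* The action morphisms are locked: otherwise rewriting with [lwM] unfolds
   them. *)
Definition cup X B : hom B (X \tx (X^v \tx B)) := locked (copair (coev D X) B).
Definition cap X B : hom (X^v \tx (X \tx B)) B := locked (pair (ev D X) B).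
(** The cap on the side opposite to [cap], available through the pivotal identification of [X] with
    its double dual. *)
Definition capp X B : hom (X \tx (X^v \tx B)) B :=
  locked (cap X^v B \oc (piv P X \rw (X^v \tx B))).

Lemma cupE X B : cup X B = copair (coev D X) B.
Proof. by rewrite /cup -lock. Qed.

Lemma capE X B : cap X B = pair (ev D X) B.
Proof. by rewrite /cap -lock. Qed.

Lemma cappE X B : capp X B = cap X^v B \oc (piv P X \rw (X^v \tx B)).
Proof. by rewrite /capp -lock. Qed.

Lemma cup_nat X B B' (g : hom B B') :
  cup X B' \oc g = (X \lw (X^v \lw g)) \oc cup X B.
Proof. by rewrite !cupE copair_nat. Qed.

Lemma cap_nat X B B' (g : hom B B') :
  cap X B' \oc (X^v \lw (X \lw g)) = g \oc cap X B.
Proof. by rewrite !capE pair_nat. Qed.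

Lemma zigzag X B : (X \lw cap X B) \oc cup X (X \tx B) = idm (X \tx B).
Proof. by rewrite cupE capE pair_copair //; case: (dualP D X). Qed.

(** Translates the mate [curry] into the calculus, so that [dualm] and [dual_tens] can be treated by
    snake identities. *)
Lemma curry_rw A X (e : hom (A \tx X) 1) B :
  curry D e \rw B = pair e (X^v \tx B) \oc (A \lw cup X B).
Proof.
rewrite /curry !rwM -la_al -!compA -/(rw e X^v) -/(lw A (coev D X)).
rewrite (reassoc (al_rw _ _ e)) -!compA.
rewrite [in LHS](reassoc (esym (pent_V _ _ _ _))) -!compA.
rewrite (reassoc (al_mid _ _ _)) -!compA -triV (reassoc (alVK _ _ _)) comp1m.
by rewrite /pair cupE /copair !lwM -?compA.
Qed.

Lemma cap_curry A X (e : hom (A \tx X) 1) B :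
  cap X B \oc (curry D e \rw (X \tx B)) = pair e B.
Proof.
rewrite curry_rw compA -pair_nat -compA -lwM.
by rewrite zigzag lw1 compm1.
Qed.

Lemma cap_dualm X Y (f : hom X Y) B :
  cap X B \oc (dualm D f \rw (X \tx B)) = cap Y B \oc (Y^v \lw (f \rw B)).
Proof. by rewrite cap_curry capE -pair_lw_rw. Qed.

Lemma cup_dualm X Y (f : hom X Y) B :
  (Y \lw (dualm D f \rw B)) \oc cup Y B = (f \rw (X^v \tx B)) \oc cup X B.
Proof.
rewrite curry_rw pair_lw_rw -capE !lwM -!compA -cup_nat.
rewrite (reassoc (esym (cup_nat _ _))) -compA.
by rewrite (reassoc (zigzag _ _)) comp1m.
Qed.

Lemma capp_dualm X Y (f : hom X Y) B :
  capp X B \oc (X \lw (dualm D f \rw B)) = capp Y B \oc (f \rw (Y^v \tx B)).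
Proof.
rewrite !cappE -!compA rwlw (reassoc (esym (cap_dualm _ _))) -compA.
by rewrite -!rwM piv_nat.
Qed.

Lemma cap_dual_tens X Y B :
  cap (X \tx Y) B \oc (dual_tens D X Y \rw ((X \tx Y) \tx B)) =
  cap Y B \oc ((Y^v \lw cap X (Y \tx B)) \oc
    ((Y^v \lw (X^v \lw al X Y B)) \oc al Y^v X^v ((X \tx Y) \tx B))).
Proof.
rewrite cap_curry.
set e := (X in pair X).
have -> : e = (ev D Y \oc (Y^v \lw cap X Y)) \oc al Y^v X^v (X \tx Y).
  by rewrite /e capE /pair -!compA.
rewrite [RHS](congr1 (comp _) (compA _ _ _)) -lwM [cap X (Y \tx B)]capE -pair_tens.
rewrite lwM -!compA -capE pent_lwVV [cap Y B]capE /pair -!compA.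
rewrite (reassoc (alV_mid _ _ _)) -!compA.
by rewrite (reassoc (alK _ _ _)) comp1m !rwM -!compA.
Qed.

(** [cap_dual_tens] rewrites [dual_tens] through two nested caps; each cap then straightens against
    one of the two nested cups. *)
Lemma cup_tens X Y B :
  (X \lw (Y \lw ((dual_tens D X Y \rw B) \oc alV Y^v X^v B))) \oc
    ((X \lw cup Y (X^v \tx B)) \oc cup X B) =
  al X Y ((X \tx Y)^v \tx B) \oc cup (X \tx Y) B.
Proof.
set B' := _ \tx B; set g := _ \oc cup (X \tx Y) B.
have -> : (dual_tens D X Y \rw B) \oc alV Y^v X^v B =
    cap Y B' \oc (Y^v \lw (cap X (Y \tx B') \oc (X^v \lw g))).
  rewrite {1}/dual_tens curry_rw -cap_curry -/(dual_tens D X Y) cap_dual_tens.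
  rewrite -!compA (reassoc (al_lw _ _ _)) -!compA alVK compm1.
  by rewrite /g !lwM.
rewrite (reassoc (esym (lwM _ _ _))) [Y \lw (_ \oc _)]lwM -compA -cup_nat.
rewrite (reassoc (zigzag _ _)) comp1m [X \lw (_ \oc _)]lwM -compA -cup_nat.
by rewrite (reassoc (zigzag _ _)) comp1m.
Qed.

(** This is where the monoidality of the pivotal structure enters: [piv_tens] reduces the claim to
    [cap_dual_tens] for the duals. *)
Lemma capp_tens X Y B :
  capp (X \tx Y) B \oc ((X \tx Y) \lw (dual_tens D X Y \rw B)) =
  capp X B \oc ((X \lw capp Y (X^v \tx B)) \oc
    ((X \lw (Y \lw al Y^v X^v B)) \oc al X Y ((Y^v \tx X^v) \tx B))).
Proof.
rewrite [in LHS]cappE -!compA rwlw (reassoc (esym (cap_dualm _ _))) -compA.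
rewrite -[in LHS]rwM piv_tens rwM.
rewrite (reassoc (cap_dual_tens _ _ _)) -!compA.
have -> : tensm M (piv P X) (piv P Y) = (piv P X \rw Y^v^v) \oc (X \lw piv P Y).
  by rewrite /rw /lw -tensm_comp comp1m compm1.
rewrite rwM (reassoc (al_rw _ _ _)) -!compA al_mid !cappE !lwM -!compA.
set m := al X Y _.
have -> : (X \lw (piv P Y \rw (Y^v \tx (X^v \tx B)))) \oc
      ((X \lw (Y \lw al Y^v X^v B)) \oc m) =
    (X \lw (Y^v^v \lw al Y^v X^v B)) \oc ((X \lw (piv P Y \rw _)) \oc m).
  by rewrite !compA -!lwM rwlw.
rewrite [in RHS](reassoc (rwlw _ _)) -!compA.
by rewrite [in RHS](reassoc (rwlw _ _)) -!compA.
Qed.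

Lemma cup_tensE X Y B :
  cup (X \tx Y) B = ((X \tx Y) \lw (dual_tens D X Y \rw B)) \oc
    (alV X Y ((Y^v \tx X^v) \tx B) \oc ((X \lw (Y \lw alV Y^v X^v B)) \oc
      ((X \lw cup Y (X^v \tx B)) \oc cup X B))).
Proof.
rewrite -[LHS]comp1m -(alK X Y) -compA -cup_tens !lwM -!compA.
by rewrite (reassoc (alV_lw _ _ _)) -!compA.
Qed.

(** * Double braidings, encircling loops and traces *)

Section Braided.
Variable b : braiding M.

Definition br X Y B : hom (X \tx (Y \tx B)) (Y \tx (X \tx B)) :=
  locked (al Y X B \oc ((braid b X Y \rw B) \oc alV X Y B)).

Lemma brE X Y B :
  br X Y B = al Y X B \oc ((braid b X Y \rw B) \oc alV X Y B).
Proof. by rewrite /br -lock. Qed.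

Lemma br_nat X Y B B' (g : hom B B') :
  br X Y B' \oc (X \lw (Y \lw g)) = (Y \lw (X \lw g)) \oc br X Y B.
Proof.
rewrite !brE -!compA alV_lw (reassoc (rwlw _ _)) -compA.
by rewrite (reassoc (al_lw _ _ _)) -compA.
Qed.

Lemma br_natl X X' Y B (f : hom X X') :
  br X' Y B \oc (f \rw (Y \tx B)) = (Y \lw (f \rw B)) \oc br X Y B.
Proof.
rewrite !brE -!compA alV_rw [(braid _ _ _ \rw _) \oc _]compA -rwM.
by rewrite braid_nat rwM -compA (reassoc (al_mid _ _ _)) -compA.
Qed.

Lemma br_natr X Y Y' B (f : hom Y Y') :
  br X Y' B \oc (X \lw (f \rw B)) = (f \rw (X \tx B)) \oc br X Y B.
Proof.
rewrite !brE -!compA alV_mid [(braid _ _ _ \rw _) \oc _]compA -rwM.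
by rewrite braid_nat rwM -compA (reassoc (al_rw _ _ _)) -compA.
Qed.

(** A hexagon axiom acting on the spectator [B], with the associators absorbed by pentagons;
    [br_tensl] is the other hexagon. *)
Lemma br_tensr X Y Z B :
  al Y Z (X \tx B) \oc br X (Y \tx Z) B =
  (Y \lw br X Z B) \oc (br X Y (Z \tx B) \oc (X \lw al Y Z B)).
Proof.
have hex : al Y Z X \oc braid b X (Y \tx Z) =
    (Y \lw braid b X Z) \oc
      (al Y X Z \oc ((braid b X Y \rw Z) \oc alV X Y Z)).
  rewrite -[LHS]compm1 -(alVK X Y Z) !compA hexagon_l -!compA.
  by [].
move/(congr1 (fun f => f \rw B)): hex; rewrite !rwM => hex.
rewrite !brE !lwM -!compA pent_VV (reassoc (esym (al_rw _ _ _))) -!compA.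
rewrite (reassoc3 (pent_lwV _ _ _ _)) -!compA.
rewrite (reassoc (esym (al_mid _ _ _))) -!compA.
rewrite (reassoc (pent _ _ _ _)) -!compA (reassoc hex) -!compA.
by [].
Qed.

Lemma br_tensl X Y Z B :
  (X \lw al Y Z B) \oc br (Y \tx Z) X B =
  br Y X (Z \tx B) \oc ((Y \lw br Z X B) \oc al Y Z (X \tx B)).
Proof.
have hex : braid b (Y \tx Z) X =
    al X Y Z \oc ((braid b Y X \rw Z) \oc (alV Y X Z \oc
      ((Y \lw braid b Z X) \oc al Y Z X))).
  rewrite [(braid b Y X \rw Z) \oc _]compA ![in RHS]compA -[in RHS]compA.
  have := hexagon_r b Y Z X; rewrite -/(rw _ _) -/(lw _ _) => h.
  rewrite -[LHS]comp1m -(alVK X Y Z) -[LHS]compm1 -(alK Y Z X).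
  by rewrite -!compA; congr (_ \oc _); rewrite !compA h -!compA.
move/(congr1 (fun f => f \rw B)): hex; rewrite !rwM => hex.
rewrite !brE !lwM -!compA pent_lwVV (reassoc (esym (al_mid _ _ _))) -!compA.
rewrite (reassoc3 (pent_V _ _ _ _)) -!compA.
rewrite (reassoc (esym (al_rw _ _ _))) -!compA.
by rewrite (reassoc (pent _ _ _ _)) -!compA hex -!compA.
Qed.

Definition dbr X Y B : hom (X \tx (Y \tx B)) (X \tx (Y \tx B)) :=
  locked (br Y X B \oc br X Y B).

Lemma dbrE X Y B : dbr X Y B = br Y X B \oc br X Y B.
Proof. by rewrite /dbr -lock. Qed.

Lemma dbr_nat X Y B B' (g : hom B B') :
  dbr X Y B' \oc (X \lw (Y \lw g)) = (X \lw (Y \lw g)) \oc dbr X Y B.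
Proof. by rewrite !dbrE -compA br_nat (reassoc (br_nat _ _ _)) -compA. Qed.

Lemma dbr_natr X Y Y' B (f : hom Y Y') :
  dbr X Y' B \oc (X \lw (f \rw B)) = (X \lw (f \rw B)) \oc dbr X Y B.
Proof. by rewrite !dbrE -compA br_natr (reassoc (br_natl _ _ _)) -compA. Qed.

(** To wind [X] around Y (x) Z, cross [Y], wind around [Z], and cross [Y] back. *)
Lemma dbr_tens X Y Z B :
  (X \lw al Y Z B) \oc dbr X (Y \tx Z) B =
  br Y X (Z \tx B) \oc ((Y \lw dbr X Z B) \oc
    (br X Y (Z \tx B) \oc (X \lw al Y Z B))).
Proof.
rewrite !dbrE (reassoc (br_tensl _ _ _ _)) -!compA br_tensr lwM -!compA.
by [].
Qed.

Lemma dbr_braid X Y B :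
  dbr X Y B = al X Y B \oc (((braid b Y X \oc braid b X Y) \rw B) \oc alV X Y B).
Proof.
by rewrite dbrE !brE rwM -!compA (reassoc (alK _ _ _)) comp1m.
Qed.

(** The strand [X] encircled by a closed loop coloured [Y] that carries [f]: a partial trace of the
    double braiding. *)
Definition ptr X Y (f : hom Y Y) A : hom (X \tx A) (X \tx A) :=
  (X \lw capp Y A) \oc ((X \lw (f \rw (Y^v \tx A))) \oc
    (dbr X Y (Y^v \tx A) \oc (X \lw cup Y A))).

(** [g] slides all the way around the loop, past the double braiding by naturality and around cup
    and cap by [cup_dualm] and [capp_dualm]. *)
Lemma ptr_cyc X Y Z (f : hom Y Z) (g : hom Z Y) A :
  ptr X (f \oc g) A = ptr X (g \oc f) A.
Proof.
rewrite /ptr !rwM !lwM -!compA.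
rewrite (reassoc (esym (dbr_natr _ _ _))) -!compA -lwM -cup_dualm lwM.
rewrite (reassoc (dbr_nat _ _ _)) -!compA.
have := esym (capp_dualm g A) => /(congr1 (fun h => X \lw h)).
rewrite !lwM => e; rewrite [RHS]compA e -!compA.
by congr (_ \oc _); set m := dbr _ _ _ \oc _; rewrite compA [RHS]compA -!lwM rwlw.
Qed.

Lemma ptr_sum X Y n (f : 'I_n -> hom Y Y) A :
  ptr X (\sum_i f i) A = \sum_i ptr X (f i) A.
Proof. by rewrite /ptr rw_sum lw_sum comp_suml comp_sumr. Qed.

Definition ptr_end X Y : hom X X :=
  ro X \oc ((X \lw (ev D Y^v \oc (piv P Y \rw Y^v))) \oc
    (al X Y Y^v \oc (((braid b Y X \oc braid b X Y) \rw Y^v) \oc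
      (alV X Y Y^v \oc ((X \lw coev D Y) \oc roV X))))).

(** The loop touches only [X], so the family comes from one endomorphism of [X]; for simple [X]
    Schur's lemma will make it a scalar. *)
Lemma ptrE X Y A : ptr X (idm Y) A = ptr_end X Y \rw A.
Proof.
rewrite /ptr rw1 lw1 comp1m cappE capE cupE /pair /copair dbr_braid.
rewrite /ptr_end.
rewrite -!compA alV_rw !rwM -tri -triV !lwM !rwM -!compA.
rewrite ![in RHS](reassoc (al_mid _ _ _)) -!compA.
rewrite [in RHS](reassoc (al_mid _ _ _)) -!compA.
rewrite [in RHS](reassoc (esym (pent_lwV _ _ _ _))) -!compA.
rewrite [in RHS](reassoc (al_rw _ _ _)) -!compA.
rewrite [in RHS](reassoc (al_rw _ _ _)) -!compA.
rewrite [in RHS](reassoc (esym (pent_V _ _ _ _))) -!compA.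
rewrite [in RHS](reassoc (al_mid _ _ _)) -!compA.
by rewrite (reassoc (alVK _ _ _)) comp1m.
Qed.

(** A loop coloured Y (x) Z is a pair of nested loops. The loop [Z] evaluates to [c], and the two
    crossings left over form the double braiding with [Y]. *)
Lemma ptr_tens X Y Z c A :
  (forall B, ptr X (idm Z) B = c *: idm (X \tx B)) ->
  ptr X (idm (Y \tx Z)) A = c *: ptr X (idm Y) A.
Proof.
move=> cP; rewrite /ptr !rw1 !lw1 !comp1m cup_tensE.
rewrite [X \lw ((_ \lw _) \oc _)]lwM (reassoc (dbr_nat _ _ _)) -!compA.
rewrite (reassoc (esym (lwM _ _ _))) capp_tens !lwM -!compA.
rewrite (reassoc (dbr_tens _ _ _ _)) -!compA.
rewrite (reassoc (esym (lwM _ (al Y Z _) _))) alVK lw1 comp1m.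
rewrite (reassoc (br_nat _ _ _)) -!compA.
rewrite (reassoc (esym (lwM Y _ _))) dbr_nat lwM -!compA.
rewrite (reassoc (br_nat _ _ _)) -!compA.
have alP : (X \lw (Y \lw (Z \lw al Z^v Y^v A))) \oc
    (X \lw (Y \lw (Z \lw alV Z^v Y^v A))) = idm _ by rewrite -!lwM alVK !lw1.
rewrite (reassoc alP) comp1m (reassoc (br_nat _ _ _)) -!compA.
rewrite (reassoc (esym (br_nat _ _ _))) -!compA.
have := congr1 (fun f => Y \lw f) (cP (Y^v \tx A)).
rewrite /ptr rw1 lw1 comp1m !lwM lwZ lw1 => cP'.
rewrite (reassoc3 cP') compZl comp1m !compZr.
by rewrite dbrE -!compA.
Qed.

Definition tr X (f : hom X X) A : hom A A :=
  capp X A \oc ((f \rw (X^v \tx A)) \oc cup X A).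

Lemma trE X (f : hom X X) A :
  tr f A = la A \oc ((ltrace P f \rw A) \oc laV A).
Proof.
rewrite /tr cappE capE cupE /pair /copair /ltrace -!compA -/(rw _ _).
rewrite !rwM -!compA (reassoc (alV_rw _ _ _)) -!compA.
rewrite (reassoc (alV_rw _ _ _)) -!compA (reassoc (alK _ _ _)) comp1m.
by [].
Qed.

Lemma tr_cyc X Y (f : hom X Y) (g : hom Y X) A :
  tr (f \oc g) A = tr (g \oc f) A.
Proof.
rewrite /tr !rwM -!compA -cup_dualm (reassoc (rwlw _ _)) -compA.
by rewrite (reassoc (capp_dualm _ _)) -compA.
Qed.

(** Closing the strand [Y] first and [X] second exhibits the Hopf link as the closure of [X]
    encircled by [Y]; this links S-matrix entries to loop scalars. *)
Lemma tr_dbr X Y A :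
  tr (braid b Y X \oc braid b X Y) A =
  capp X A \oc (ptr X (idm Y) (X^v \tx A) \oc cup X A).
Proof.
rewrite /tr /ptr rw1 lw1 comp1m cup_tensE (reassoc (rwlw _ _)) -!compA.
rewrite (reassoc (capp_tens _ _ _)) -!compA.
rewrite (reassoc3 (esym (dbr_braid _ _ _))) (reassoc (dbr_nat _ _ _)) -!compA.
have alP : (X \lw (Y \lw al Y^v X^v A)) \oc
    (X \lw (Y \lw alV Y^v X^v A)) = idm _ by rewrite -!lwM alVK !lw1.
by rewrite (reassoc alP) comp1m.
Qed.

End Braided.
End Duality.
End Whiskering.

(** * Fusion coefficients and the S-matrix *)

Section Schur.
Variables (k : closedFieldType) (C : linearCategory k).
Hypothesis abelC : abelian_category C.

(** The kernel of [g] is a subobject of [X]: if it is all of [X] then [g] vanishes, and if it is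
    zero then [g] is mono, hence invertible by simplicity. *)
Lemma simple_zero_or_iso (X : C) (g : hom X X) :
  simple_ob X -> g = 0 \/ is_iso g.
Proof.
move=> [nzX simX]; have [K [i [gi0 univ]]] := abelian_ker abelC g.
have mono_i : is_mono i.
  move=> W a b ab; have [|c [_ uniq]] := univ W (i \oc b).
    by rewrite compA gi0 comp0m.
  by rewrite -(uniq a ab) -(uniq b erefl).
have [zK|[j [_ ij]]] := simX K i mono_i; last first.
  by left; rewrite -[g]compm1 -ij compA gi0 comp0m.
right; have mono_g : is_mono g.
  move=> W a b ab; apply/eqP; rewrite -subr_eq0.
  have [|c [<- _]] := univ W (a - b).
    by rewrite -scaleN1r compDr compZr ab scaleN1r subrr.
  by rewrite -[c]comp1m (zK : idm K = 0) comp0m compm0.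
by have [] := simX X g mono_g.
Qed.

(** Composition with [f] is a linear operator on the finite-dimensional space End(X), so it has an
    eigenvalue [c]. Then [f - c *: idm X] kills a nonzero endomorphism and cannot be invertible. *)
Lemma schur (X : C) (f : hom X X) :
  simple_ob X -> exists c, f = c *: idm X.
Proof.
move=> simX; have [nzX _] := simX.
pose V := hom X X : vectType k.
pose F (v : 'rV[k]_(dim V)) : 'rV_(dim V) := v2r (f \oc (r2v v : V) : V).
have linF : linear F.
  by move=> a u v; rewrite /F linearP compDr compZr linearP.
pose A := lin1_mx (HB.pack_for {linear 'rV_(dim V) -> 'rV_(dim V)} F
  (GRing.isLinear.Build _ _ _ _ F linF)).
have n_gt0 : (0 < dim V)%N.
  rewrite lt0n; apply/eqP => d0; apply: nzX; rewrite /is_zero.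
  apply: (can_inj (@v2rK _ V)); apply/rowP => j.
  by have := ltn_ord j; rewrite [X in (_ < X)%N -> _]d0.
have [c] : exists c, root (char_poly A) c.
  apply/closed_rootP; rewrite size_char_poly.
  by case: (dim V) n_gt0.
rewrite -eigenvalue_root_char => /eigenvalueP[v vA v0].
exists c; apply/eqP; rewrite -subr_eq0.
have fv : (f - c *: idm X) \oc (r2v v : V) = 0.
  rewrite compDl -scaleN1r !compZl comp1m scaleN1r; apply/eqP.
  rewrite subr_eq0; apply/eqP; apply: (can_inj (@v2rK _ V)).
  rewrite linearZ /= r2vK -vA.
  by rewrite mul_rV_lin1.
have [/eqP//|[g [gf _]]] := simple_zero_or_iso (f - c *: idm X) simX.
case/negP: v0; rewrite -(inj_eq (can_inj (@r2vK _ V))) linear0.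
by rewrite -[X in X == _]comp1m -gf -compA fv compm0.
Qed.

Lemma scalar_ofE (X : C) (f : hom X X) :
  simple_ob X -> f = scalar_of f *: idm X.
Proof.
move=> simX; have [c fc] := schur f simX.
by rewrite /scalar_of; case: xgetP => [d _ //|/(_ c)].
Qed.

Lemma scalar_ofP (X : C) (f : hom X X) c :
  simple_ob X -> f = c *: idm X -> scalar_of f = c.
Proof.
move=> simX fc; have := scalar_ofE f simX; rewrite {1}fc => /eqP.
rewrite -subr_eq0 -scalerBl scaler_eq0 subr_eq0 => /orP[/eqP//|/eqP z].
by case: simX.
Qed.

End Schur.

(** * Loop scalars as characters of the fusion ring, and the Verlinde relation *)

Section Verlinde.
Variables (k : closedFieldType) (C : modularFusion k).
Local Notation M := (bsf_mon C).
Local Notation P := (bsf_piv C).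
Local Notation b := (bsf_braid C).
Local Notation "1" := (unit_ob M).
Implicit Types X Y Z : C.

Let abelC := bsf_abelian C.

Lemma rw_unit_scalar X (f : hom X X) c :
  rw M f 1 = c *: idm (tens M X 1) -> f = c *: idm X.
Proof.
move=> e; rewrite -[f]compm1 -(roVK M X) compA -runit_nat -/(rw M f 1) e.
by rewrite compZr compm1 compZl roVK.
Qed.

(** For simple [X], the scalar of a [Y]-loop around [X]. As a function of [Y] it is multiplicative,
    additive and isomorphism invariant. *)
Definition phi X Y : k := scalar_of (ptr_end P b X Y).

Lemma phiE X Y A : simple_ob X ->
  ptr P b X (idm Y) A = phi X Y *: idm (tens M X A).
Proof.
by move=> simX; rewrite ptrE {1}[ptr_end _ _ _ _](scalar_ofE abelC) // rwZ rw1.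
Qed.

Lemma phiP X Y c : simple_ob X ->
  (forall A, ptr P b X (idm Y) A = c *: idm (tens M X A)) -> phi X Y = c.
Proof.
move=> simX e; apply: (scalar_ofP abelC) => //; apply: rw_unit_scalar.
by rewrite -ptrE e.
Qed.

Lemma phi_tens X Y Z : simple_ob X ->
  phi X (tens M Y Z) = phi X Y * phi X Z.
Proof.
move=> simX; apply: phiP => // A; rewrite (@ptr_tens _ _ _ _ _ _ _ _ _ (phi X Z)).
  by rewrite phiE // scalerA mulrC.
by move=> B; apply: phiE.
Qed.

Lemma phi_iso X Y Z : simple_ob X -> isomorphic Y Z -> phi X Y = phi X Z.
Proof.
move=> simX [f [g [gf fg]]]; apply: phiP => // A.
by rewrite -gf ptr_cyc fg phiE.
Qed.

Lemma phi_sum X Y n (Z : 'I_n -> C) :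
  simple_ob X -> is_direct_sum Z Y -> phi X Y = \sum_j phi X (Z j).
Proof.
move=> simX [i [r [ri _ ir]]]; apply: phiP => // A.
rewrite -ir ptr_sum scaler_suml; apply: eq_bigr => j _.
by rewrite ptr_cyc ri phiE.
Qed.

Lemma tr_Tr X (f : hom X X) A : tr P f A = Tr f *: idm A.
Proof.
rewrite trE [ltrace P f](scalar_ofE abelC) ?rwZ ?rw1; last exact: bsf_unit.
by rewrite compZl comp1m compZr laVK.
Qed.

Lemma Tr_uniq X (f : hom X X) c : tr P f 1 = c *: idm 1 -> Tr f = c.
Proof.
rewrite tr_Tr => /eqP; rewrite -subr_eq0 -scalerBl scaler_eq0 subr_eq0.
by case/orP => /eqP // z; case: (bsf_unit C).
Qed.

Local Notation S := (Smatrix C).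
Local Notation s := (simple_rep C).

Lemma Smatrix_sym i j : S i j = S j i.
Proof. by rewrite !mxE; apply: Tr_uniq; rewrite tr_cyc tr_Tr. Qed.

Lemma Smatrix_phi i j : S i j = Tr (idm (s i)) * phi (s i) (s j).
Proof.
rewrite mxE; apply: Tr_uniq; rewrite tr_dbr phiE; last exact: simple_repP.
rewrite compZl comp1m compZr mulrC -scalerA; congr (_ *: _).
by rewrite -tr_Tr /tr rw1 comp1m.
Qed.

Theorem verlinde : exists (o : 'I_(num_simple C))
    (N : 'I_(num_simple C) -> 'I_(num_simple C) -> 'I_(num_simple C) -> nat),
  forall i j l, S i l * S j l = S o l * \sum_m (N i j m)%:R * S m l.
Proof.
have [u [iso_u _]] := simple_rep_uniq (bsf_unit C).
exists u.
have phi_o l : phi (s l) (s u) = GRing.one _.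
  have simX := simple_repP l.
  (* As 1 (x) Y is isomorphic to Y, each value of [phi (s l)] absorbs the factor [phi (s l) 1]. If
     this factor were 0, row [l] of [S] would vanish, against non-degeneracy. *)
  have mul1 Y : phi (s l) Y = phi (s l) 1 * phi (s l) Y.
    rewrite -phi_tens //; apply: phi_iso => //.
    by exists (lunitV M Y), (lunit M Y); case: (lunit_inv M Y).
  rewrite -(phi_iso simX iso_u).
  have [z|nz] := eqVneq (phi (s l) 1) 0; last first.
    by apply: (mulIf nz); rewrite -mul1 mul1r.
  have row0 : row l S = 0.
    by apply/rowP => j; rewrite mxE Smatrix_phi mul1 z mul0r mulr0 mxE.
  have := mulmxV (mod_nondeg C) => /(congr1 (row l)).
  rewrite row_mul row0 mul0mx => /rowP/(_ l)/eqP.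
  by rewrite !mxE eqxx eq_sym oner_eq0.
have fusion (ij : 'I_(num_simple C) * 'I_(num_simple C)) :
    exists n : 'I_(num_simple C) -> nat, forall l,
      phi (s l) (s ij.1) * phi (s l) (s ij.2) = \sum_m (n m)%:R * phi (s l) (s m).
  have [n [Y [simY sumY]]] :=
    bsf_semisimple (tens M (s ij.1) (s ij.2)).
  have ex_t a : exists m, isomorphic (Y a) (s m).
    by have [m [? _]] := simple_rep_uniq (simY a); exists m.
  have [t tP] := boolp.choice ex_t.
  (* The fusion coefficient is the number of summands of the tensor product isomorphic to [s m]. *)
  exists (fun m => #|[pred a | t a == m]|) => l; have simX := simple_repP l.
  rewrite -phi_tens // (phi_sum simX sumY) (partition_big t xpredT) //=.
  apply: eq_bigr => m _; rewrite mulr_natl -sumr_const.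
  by apply: eq_big => // a /eqP <-; apply: phi_iso.
have [n nP] := boolp.choice fusion.
exists (fun i j => n (i, j)) => i j l.
(* With d the trace of the identity of [s l], S_il = d phi(s l, s i) and S_ol = d, so the relation
   is the fusion rule for [phi] times d^2. *)
rewrite ![S _ l]Smatrix_sym !Smatrix_phi phi_o mulr1 mulrACA (nP (i, j)) -mulrA.
congr (_ * _); rewrite mulr_sumr; apply: eq_bigr => m _.
by rewrite Smatrix_sym Smatrix_phi mulrCA.
Qed.

End Verlinde.

Local Close Scope cat_scope.

(** * Rational roots of integer polynomials *)

Section RationalRoots.
Variable K : numFieldType.
Implicit Types (f g : {poly rat}) (x : K).
Local Notation "f ^K" := (map_poly (@ratr K) f) (at level 2, format "f ^K").

(** For irrational algebraic [x] the minimal polynomial has degree at least 2 and a simple root at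
    [x]; dividing it out of [f] lowers the multiplicity by at most 1 and the size by at least 2. For
    transcendental [x] the multiplicity is 0. *)
Lemma rat_or_large_degree f x : f != 0 ->
  (exists r, x = ratr r) \/ ((mup x f^K).*2 < size f)%N.
Proof.
have map0 g : (g^K == 0) = (g == 0) by rewrite map_poly_eq0.
have [nrt|rt] := boolP `[< exists g, g != 0 /\ root g^K x >]; last first.
  move=> f0; right; rewrite mupNroot ?size_poly_gt0 //.
  by apply: contra rt => ?; apply/asboolP; exists f.
have [] := @ex_minnP (fun d => `[< exists g, [/\ g != 0, root g^K x & size g = d] >]).
  by move/asboolP: nrt => [g [? ?]]; exists (size g); apply/asboolP; exists g.
move=> d /asboolP[g [g0 rg sg]] min_g f0.
have minP h : h != 0 -> root h^K x -> (size g <= size h)%N.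
  by move=> h0 rh; rewrite sg; apply: min_g; apply/asboolP; exists h.
have g1 : (1 < size g)%N.
  by rewrite -(size_map_poly (@ratr K)); apply: root_size_gt1 rg; rewrite map0.
have [g2|g2] := leqP (size g) 2; [left|right].
  have {}sg : size g = 2%N by apply/eqP; rewrite eqn_leq g2.
  have lg : g`_1 != 0 by move: g0; rewrite -lead_coef_eq0 lead_coefE sg.
  exists (- g`_0 / g`_1); move: rg; rewrite /root horner_coef size_map_poly sg.
  rewrite 2!big_ord_recl big_ord0 !coef_map /= expr0 mulr1 addr0 expr1.
  rewrite fmorph_div rmorphN addrC addr_eq0 => /eqP <-.
  by rewrite mulrAC divff ?mul1r // fmorph_eq0.
(* In characteristic 0 a double root would also be a root of the nonzero derivative, which is
   smaller than the minimal [g]. *)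
have mup_g : (mup x g^K <= 1)%N.
  rewrite mup_leq ?map0 //; apply/negP => /dvdpP[h gh].
  have rg' : root (g^`())^K x.
    rewrite rootE -deriv_map gh expr2 !derivM derivXsubC.
    rewrite !(hornerM, hornerD, hornerN, hornerX, hornerC) subrr.
    by rewrite !(mulr0, mul0r, addr0).
  have g'0 : g^`() != 0.
    apply: contraTneq g0 => /(congr1 (fun h : {poly rat} => h`_(size g).-2)).
    rewrite coef_deriv coef0 prednK ?ltn_predRL // -lead_coefE => /eqP.
    by rewrite mulrn_eq0 lead_coef_eq0; move: g1; case: (size g) => [|[|?]] //= _ ->.
  by have := minP _ g'0 rg'; rewrite leqNgt lt_size_deriv.
move: {-2}f (leqnn (size f)) f0.
elim: (size f) => [|n IHn] h.
  by rewrite leqn0 size_poly_eq0 => /eqP->; rewrite eqxx.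
move=> sh h0; have [rh|rh] := boolP (root h^K x); last first.
  by rewrite mupNroot // size_poly_gt0.
have /dvdpP[h1 hE] : g %| h.
  apply: contraLR isT => /negPf nd.
  have m0 : h %% g != 0 by rewrite -/(dvdp g h) nd.
  have : root (h %% g)^K x.
    have := congr1 (map_poly (@ratr K)) (divp_eq h g).
    rewrite rmorphD rmorphM /= => /(congr1 (horner^~ x)).
    rewrite !hornerE (rootP rg) (rootP rh) mulr0 add0r => e.
    by rewrite /root -e.
  by move/(minP _ m0); rewrite leqNgt ltn_modp g0.
have h10 : h1 != 0 by apply: contraNneq h0 => z; rewrite hE z mul0r.
have szh : size h = (size h1 + (size g).-1)%N.
  by rewrite hE size_mul // -subn1 -addnBA ?subn1 // ltnW.
have /IHn/(_ h10) : (size h1 <= n)%N by lia.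
rewrite hE rmorphM /= mupM ?map0 // -hE szh.
move: mup_g g2; clear.
by move: (mup _ _) (mup _ _) (size _) (size _) => a b c m; lia.
Qed.

(** The root is moved from [K] to the algebraic numbers, where a rational algebraic integer is an
    integer. *)
Lemma rational_root_int (f : {poly int}) (r : rat) :
  f \is monic -> root (map_poly intr f) (ratr r : K) -> exists z : int, r = z%:~R.
Proof.
move=> mon_f rt.
have rat_root : root (map_poly (intr : int -> rat) f) r.
  rewrite -(fmorph_root (@ratr K)) -map_poly_comp.
  by rewrite (eq_map_poly (g := intr)) // => z /=; rewrite ratr_int.
have : root (map_poly (intr : int -> algC) f) (ratr r).
  rewrite -(fmorph_root (@ratr algC)) -map_poly_comp in rat_root.
  by rewrite (eq_map_poly (g := intr)) // in rat_root => z /=; rewrite ratr_int.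
move/root_monic_Aint => /(_ (monic_map _ mon_f)) int_r.
have /intrP[z rz] : (ratr r : algC) \is a Num.int.
  apply: Cint_rat_Aint; first by apply/CratP; exists r.
  by apply: int_r; apply/polyOverP => i; rewrite coef_map /= intr_int.
by exists z; apply: (fmorph_inj (@ratr algC)); rewrite /= rz ratr_int.
Qed.

End RationalRoots.

(** * The shape of the S-matrix *)

Section Orthogonal.
Variables (K : numClosedFieldType) (n : nat) (side : pred 'I_n) (e f q1 : 'I_n).
Variables (s : 'M[K]_n) (D : 'rV[K]_n).
Hypotheses (side_e : side e) (side_f : ~~ side f).
Hypotheses (side_q1 : ~~ side q1) (q1f : q1 != f).
Hypothesis s_sym : s^T = s.
Hypothesis s_cross : forall i j, side i != side j -> s i j = 0.
Hypothesis s_e : forall l, side l -> s e l != 0.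
Hypothesis s_f : forall l, ~~ side l -> s f l != 0.
Hypothesis D_inj : forall i j, D 0 i = D 0 j ->
  i = j \/ i \in [:: e; f] /\ j \in [:: e; f].

(** Schur's lemma in coordinates: commuting with [D] leaves only the entries (e,f) and (f,e) off the
    diagonal, commuting with [s] kills these, and the zero-free rows [e] and [f] of [s] spread the
    diagonal values over each block. *)
Lemma commutant_diag (A : 'M[K]_n) :
  A^T = A -> A *m s = s *m A -> A *m diag_mx D = diag_mx D *m A ->
  A = diag_mx (\row_l if side l then A e e else A f f).
Proof.
move=> A_sym As AD.
have off i j : i != j -> A i j != 0 -> i \in [:: e; f] /\ j \in [:: e; f].
  move=> ij Aij; have := congr1 (fun B : 'M[K]_n => B i j) AD.
  rewrite mul_mx_diag mul_diag_mx !mxE mulrC => /(mulIf Aij)/esym/D_inj.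
  by case=> // /eqP; rewrite (negPf ij).
have ef : e != f by apply: contraNneq side_f => <-.
(* Compare the entries (e,q1) of [A *m s] and [s *m A]: the first is A_ef s_{f,q1} with s_{f,q1}
   nonzero, the second is 0. *)
have Aef : A e f = 0.
  have := congr1 (fun B : 'M[K]_n => B e q1) As; rewrite !mxE.
  rewrite (bigD1 f) //= big1 => [|i i_f]; last first.
    have [->|ie] := eqVneq i e; first by rewrite s_cross ?mulr0 // side_e (negPf side_q1).
    have [->|nz] := eqVneq (A e i) 0; first by rewrite mul0r.
    have [] := off e i _ nz; first by rewrite eq_sym.
    by rewrite !inE (negPf ie) (negPf i_f).
  rewrite addr0 big1 => [|i _].
    by move/eqP; rewrite mulf_eq0 (negPf (s_f side_q1)) orbF => /eqP.
  have [->|iq] := eqVneq i q1; first by rewrite s_cross ?mul0r // side_e (negPf side_q1).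
  have [->|nz] := eqVneq (A i q1) 0; first by rewrite mulr0.
  have [_] := off i q1 iq nz; rewrite !inE (negPf q1f) orbF => /eqP q1e.
  by move: side_q1; rewrite q1e side_e.
have diag i j : i != j -> A i j = 0.
  move=> ij; apply/eqP; apply: contraT => nz.
  have [] := off i j ij nz; rewrite !inE.
  move=> /orP[]/eqP ie /orP[]/eqP je; subst; rewrite ?eqxx // in ij nz.
    by rewrite Aef eqxx in nz.
  by rewrite -A_sym mxE Aef eqxx in nz.
have comm i j : s i j != 0 -> A i i = A j j.
  move=> sij; have := congr1 (fun B : 'M[K]_n => B i j) As; rewrite !mxE.
  rewrite (bigD1 i) //= big1 => [|l li]; last by rewrite diag ?mul0r // eq_sym.
  rewrite [in RHS](bigD1 j) //= [X in _ = _ + X]big1 => [|l lj].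
    by rewrite !addr0 mulrC => /(mulfI sij).
  by rewrite diag ?mulr0.
apply/matrixP => i j; rewrite !mxE.
have [<-|ij] := eqVneq i j; last by rewrite diag ?mulr0n.
rewrite mulr1n; case: ifP => si; first by rewrite (comm e i) ?s_e.
by rewrite (comm f i) ?s_f // si.
Qed.

(** Since [S] and [t] are symmetric, Q^T Q commutes with [s] and [D], so it is a scalar on each
    block. Dividing [Q] by square roots of these scalars makes it orthogonal. *)
Lemma orthogonal_intertwiner (S : 'M[K]_n) (t : 'rV[K]_n) (Q : 'M[K]_n) :
    S^T = S -> Q \in unitmx -> S *m Q = Q *m s ->
    diag_mx t *m Q = Q *m diag_mx D ->
  exists U : 'M[K]_n,
    [/\ U *m U^T = 1%:M, S *m U = U *m s & diag_mx t *m U = U *m diag_mx D].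
Proof.
move=> S_sym Qu SQ tQ; pose A := Q^T *m Q.
have A_sym : A^T = A by rewrite trmx_mul trmxK.
have As : A *m s = s *m A.
  by rewrite -mulmxA -SQ mulmxA -{1}S_sym -trmx_mul SQ trmx_mul s_sym mulmxA.
have AD : A *m diag_mx D = diag_mx D *m A.
  rewrite -mulmxA -tQ mulmxA -{1}[diag_mx t]tr_diag_mx -trmx_mul tQ trmx_mul.
  by rewrite tr_diag_mx mulmxA.
have Au : A \in unitmx by rewrite unitmx_mul unitmx_tr Qu.
have AE : Q^T *m Q = A by []; clearbody A.
have A_diag := commutant_diag A_sym As AD; set d := (X in diag_mx X) in A_diag.
have d_nz l : d 0 l != 0.
  move: Au; rewrite A_diag unitmxE det_diag unitfE => /prodf_neq0; exact.
pose r : 'rV[K]_n := \row_l (sqrtC (d 0 l))^-1.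
have dr : diag_mx r *m diag_mx d *m diag_mx r = 1%:M.
  rewrite !mulmx_diag -[RHS]diag_const_mx; congr diag_mx; apply/rowP => l.
  rewrite !mxE mulrAC -invfM -expr2 sqrtCK mulVf //.
  by have := d_nz l; rewrite mxE.
have rs : diag_mx r *m s = s *m diag_mx r.
  apply/matrixP => i j; rewrite mul_mx_diag mul_diag_mx !mxE mulrC.
  have [sij|/s_cross->] := eqVneq (side i) (side j); last by rewrite !mul0r.
  by rewrite sij.
exists (Q *m diag_mx r); split.
- apply: mulmx1C; rewrite trmx_mul tr_diag_mx mulmxA -[X in X *m _]mulmxA.
  by rewrite AE A_diag dr.
- by rewrite mulmxA SQ -!mulmxA rs.
- by rewrite mulmxA tQ -!mulmxA diag_mxC.
Qed.

End Orthogonal.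

(** * Position of the unit object and of its partner in the orthogonal intertwiner *)

Section Shape.
Variables (K : numClosedFieldType) (n : nat) (side : pred 'I_n) (e f p1 q1 : 'I_n).
Variables (s U S : 'M[K]_n) (t D : 'rV[K]_n) (z : 'I_n).
Hypotheses (side_e : side e) (side_f : ~~ side f).
Hypotheses (side_p1 : side p1) (side_q1 : ~~ side q1).
Hypotheses (p1e : p1 != e) (q1f : q1 != f).
Hypothesis s_cross : forall i j, side i != side j -> s i j = 0.
Hypothesis D_inj : forall i j, D 0 i = D 0 j ->
  i = j \/ i \in [:: e; f] /\ j \in [:: e; f].
Hypothesis UUt : U *m U^T = 1%:M.
Hypothesis SU : S *m U = U *m s.
Hypothesis tU : diag_mx t *m U = U *m diag_mx D.
Hypothesis Sz : forall i, S z i != 0.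

Let UtU : U^T *m U = 1%:M := mulmx1C UUt.
Let ef : e != f. Proof. by apply: contraNneq side_f => <-. Qed.
Let p1N : p1 \notin [:: e; f].
Proof. by rewrite !inE negb_or p1e; apply: contraNneq side_f => <-. Qed.
Let q1N : q1 \notin [:: e; f].
Proof. by rewrite !inE negb_or q1f andbT; apply: contraNneq side_q1 => ->. Qed.

(** A row of [U] lives on one eigenspace of [D], and at most [e] and [f] share an eigenvalue. *)
Lemma row_support i j l : U i j != 0 -> U i l != 0 ->
  j = l \/ j \in [:: e; f] /\ l \in [:: e; f].
Proof.
have eq_D m : U i m != 0 -> D 0 m = t 0 i.
  move=> Uim; have := congr1 (fun B : 'M[K]_n => B i m) tU.
  by rewrite mul_mx_diag mul_diag_mx !mxE mulrC => /(mulfI Uim).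
by move=> /eq_D Dj /eq_D Dl; apply: D_inj; rewrite Dj.
Qed.

Lemma row_simple i l m : l \notin [:: e; f] -> U i l != 0 -> m != l -> U i m = 0.
Proof.
move=> lN Uil ml; apply/eqP; apply: contraT => Uim.
by have [/eqP|[_]] := row_support Uim Uil; rewrite ?(negPf ml) ?(negPf lN).
Qed.

Lemma conj_simple (X : 'M[K]_n) i l j : l \notin [:: e; f] -> U i l != 0 ->
  (U *m X *m U^T) j i = (\sum_m U j m * X m l) * U i l.
Proof.
move=> lN Uil; rewrite !mxE (bigD1 l) //= big1 ?addr0 => [|m ml].
  by rewrite !mxE.
by rewrite !mxE (row_simple lN Uil ml) mulr0.
Qed.

Lemma row_norm i : \sum_l U i l ^+ 2 = 1.
Proof.
have := congr1 (fun B : 'M[K]_n => B i i) UUt; rewrite !mxE eqxx => UUi.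
by rewrite -[RHS]UUi; apply: eq_bigr => l _; rewrite !mxE expr2.
Qed.

Lemma row_simple_norm i l : l \notin [:: e; f] -> U i l != 0 -> U i l ^+ 2 = 1.
Proof.
move=> lN Uil; rewrite -(row_norm i) (bigD1 l) //= big1 ?addr0 // => m ml.
by rewrite (row_simple lN Uil ml) expr0n.
Qed.

Lemma col_nonzero l : exists i, U i l != 0.
Proof.
apply/existsP; apply: contraT; rewrite negb_exists => /forallP Ul.
have := congr1 (fun B : 'M[K]_n => B l l) UtU; rewrite !mxE eqxx big1 => [/eqP|i _].
  by rewrite eq_sym oner_eq0.
by rewrite (eqP (negbNE (Ul i))) mulr0.
Qed.

Lemma S_conj : S = U *m s *m U^T.
Proof. by rewrite -SU -mulmxA UUt mulmx1. Qed.

(* No row supported on one summand is orthogonal to the unit row, so the unit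
   lies in the common eigenspace of the two summands. *)
Lemma unit_row l : l \notin [:: e; f] -> U z l = 0.
Proof.
move=> lN; apply/eqP; apply: contraT => Uzl.
have [m mN sm] : exists2 m, m \notin [:: e; f] & side m != side l.
  by have [sl|sl] := boolP (side l); [exists q1 | exists p1];
    rewrite ?side_p1 ?(negPf side_q1).
have [i Uim] := col_nonzero m.
have := Sz i; rewrite S_conj (conj_simple _ _ mN Uim) big1 ?mul0r ?eqxx // => a _.
have [->|al] := eqVneq a l; first by rewrite s_cross ?mulr0 // eq_sym.
by rewrite (row_simple lN Uzl al) mul0r.
Qed.

Lemma sum_ef (F : 'I_n -> K) : (forall l, l \notin [:: e; f] -> F l = 0) ->
  \sum_l F l = F e + F f.
Proof.
move=> F0; rewrite (bigD1 e) //= (bigD1 f) 1?eq_sym //= big1 ?addr0 // => l.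
by case/andP=> le lf; rewrite F0 // !inE negb_or le.
Qed.

Lemma conj_ef (X : 'M[K]_n) i j : (forall i j, side i != side j -> X i j = 0) ->
  (forall l, l \notin [:: e; f] -> U i l = 0) ->
  (forall l, l \notin [:: e; f] -> U j l = 0) ->
  (U *m X *m U^T) i j = U i e * X e e * U j e + U i f * X f f * U j f.
Proof.
move=> Xc Ui Uj; rewrite mxE (sum_ef (F := fun l => _)) => [|l lN].
  rewrite !mxE !(sum_ef (F := fun l => _)); try by move=> l lN; rewrite Ui ?mul0r.
  by rewrite [X e f]Xc ?[X f e]Xc ?side_e ?(negPf side_f) // !mulr0 addr0 add0r.
by rewrite [X in _ * X]mxE Uj ?mulr0.
Qed.

Lemma conj_e (X : 'M[K]_n) i j l : (forall i j, side i != side j -> X i j = 0) ->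
  l \notin [:: e; f] -> U i l != 0 ->
  (forall l, l \notin [:: e; f] -> U j l = 0) ->
  (U *m X *m U^T) j i =
    (if side l then U j e * X e l else U j f * X f l) * U i l.
Proof.
move=> Xc lN Uil Uj; rewrite (conj_simple _ _ lN Uil); congr (_ * _).
rewrite (sum_ef (F := fun m => _)) => [|m mN]; last by rewrite Uj ?mul0r.
case: ifP => sl; first by rewrite [X f l]Xc ?mulr0 ?addr0 // sl (negPf side_f).
by rewrite [X e l]Xc ?mulr0 ?add0r // sl side_e.
Qed.

Lemma intertwiner_shape : exists (B : 'I_n) (h : 'I_n -> 'I_n) (u v sg : K),
  [/\ u ^+ 2 + v ^+ 2 = 1, u != 0, v != 0 & sg ^+ 2 = 1] /\
  [/\ injective h, h e = z, h f = B,
      forall l, l \notin [:: e; f] -> U (h l) l != 0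
    & [/\ forall l, l \notin [:: e; f] -> U z l = 0 /\ U B l = 0,
          U z e = u, U z f = v, U B e = - sg * v & U B f = sg * u]].
Proof.
have Uz_norm : U z e ^+ 2 + U z f ^+ 2 = 1.
  rewrite -(row_norm z) (sum_ef (F := fun m => _)) // => m mN.
  by rewrite unit_row ?expr0n.
(* For a row [i] meeting column [p1], the entry S_zi has the factor [U z e], and the unit row of [S]
   has no zero. *)
have Uze : U z e != 0.
  have [i Ui] := col_nonzero p1; have := Sz i.
  rewrite S_conj (conj_e s_cross p1N Ui unit_row) side_p1.
  by apply: contraNneq => ->; rewrite !mul0r.
have Uzf : U z f != 0.
  have [i Ui] := col_nonzero q1; have := Sz i.
  rewrite S_conj (conj_e s_cross q1N Ui unit_row) (negPf side_q1).
  by apply: contraNneq => ->; rewrite !mul0r.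
(* Columns [e] and [f] are orthogonal while row [z] contributes a nonzero product, so some other row
   must contribute too. *)
have [B Bz UB] : exists2 B, B != z & U B e * U B f != 0.
  apply/exists_inP; apply: contraT; rewrite negb_exists_in => /forall_inP UB.
  have := congr1 (fun B : 'M[K]_n => B e f) UtU; rewrite !mxE (negPf ef).
  rewrite (bigD1 z) //= big1 => [/eqP|i iz].
    by rewrite !mxE addr0 mulf_eq0 (negPf Uze) (negPf Uzf).
  by rewrite !mxE; apply/eqP/negbNE/UB.
have {UB} [UBe UBf] : U B e != 0 /\ U B f != 0.
  by apply/andP; rewrite mulf_eq0 negb_or in UB.
have UB0 l : l \notin [:: e; f] -> U B l = 0.
  move=> lN; apply/eqP; apply: contraT => UBl.
  rewrite (row_simple lN UBl) ?eqxx // in UBe.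
  by apply: contraNneq lN => <-; rewrite inE eqxx.
have UB_norm : U B e ^+ 2 + U B f ^+ 2 = 1.
  rewrite -(row_norm B) (sum_ef (F := fun m => _)) // => m mN.
  by rewrite UB0 ?expr0n.
have zB : U z e * U B e + U z f * U B f = 0.
  have := congr1 (fun A : 'M[K]_n => A z B) UUt; rewrite !mxE eq_sym (negPf Bz) => UzB.
  rewrite -[RHS]UzB (sum_ef (F := fun m => _)) ?mxE // => m mN.
  by rewrite unit_row ?mul0r.
have [g gP] := boolp.choice col_nonzero.
exists B, (fun l => if l == e then z else if l == f then B else g l).
(* [sg] is the determinant of the 2x2 block on rows [z], [B] and columns [e], [f]; Lagrange's
   identity shows that its square is 1. *)
exists (U z e), (U z f), (U z e * U B f - U z f * U B e); split; split=> //.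
- transitivity ((U z e ^+ 2 + U z f ^+ 2) * (U B e ^+ 2 + U B f ^+ 2)
     - (U z e * U B e + U z f * U B f) ^+ 2); first by ring.
  by rewrite zB Uz_norm UB_norm expr0n mulr1 subr0.
- have gN l : l \notin [:: e; f] -> g l != z /\ g l != B.
    by move=> lN; split; apply: contraNneq (gP l) => ->; rewrite ?unit_row ?UB0.
  have ginj l m : l \notin [:: e; f] -> g l = g m -> l = m.
    move=> lN glm; apply/esym/eqP; apply: contraT => lm.
    by have := gP m; rewrite -glm (row_simple lN (gP l)) ?eqxx.
  have N l : l != e -> l != f -> l \notin [:: e; f].
    by move=> *; rewrite !inE negb_or; apply/andP.
  move=> l m /=; case: (eqVneq l e) => [->|le]; case: (eqVneq m e) => [->|me] //.
  + by case: eqVneq => [_ /esym/eqP|mf /esym/eqP]; rewrite ?(negPf Bz) //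
      (negPf (proj1 (gN m _))) // N.
  + by case: eqVneq => [_ /eqP|mf /eqP]; rewrite ?(negPf Bz) //
      (negPf (proj1 (gN l _))) // N.
  + case: (eqVneq l f) => [->|lf]; case: (eqVneq m f) => [->|mf] //.
    * by move=> /esym/eqP; rewrite (negPf (proj2 (gN m _))) // N.
    * by move=> /eqP; rewrite (negPf (proj2 (gN l _))) // N.
    * by apply: ginj; apply: N.
- by rewrite eqxx.
- by rewrite eq_sym (negPf ef) eqxx.
- by move=> l; rewrite !inE negb_or => /andP[/negPf-> /negPf->].
split=> //.
- by move=> l lN; rewrite unit_row ?UB0.
- transitivity (U B e * (U z e ^+ 2 + U z f ^+ 2)
      - U z e * (U z e * U B e + U z f * U B f)); last by ring.
  by rewrite zB Uz_norm; ring.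
- transitivity (U B f * (U z e ^+ 2 + U z f ^+ 2)
      - U z f * (U z e * U B e + U z f * U B f)); last by ring.
  by rewrite zB Uz_norm; ring.
Qed.

End Shape.

(** * Eigenvalues of the fusion matrix *)

Lemma char_poly_intertwine (F : fieldType) n (A B S : 'M[F]_n) :
  S \in unitmx -> A *m S = S *m B -> char_poly A = char_poly B.
Proof.
move=> Su AS; pose SC := map_mx polyC S.
have detS : \det SC != 0.
  by rewrite det_map_mx polyC_eq0 -unitfE -unitmxE.
apply: (mulIf detS); rewrite [RHS]mulrC -!det_mulmx; congr (\det _).
rewrite /char_poly_mx mulmxBl mulmxBr -!map_mxM AS.
by rewrite scalar_mxC.
Qed.

(** * Equality of the two signs and the bound on the gap, with p = 2 P1 + 1 and q = 2 Q1 + 1 *)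

Section Gap.
Variables (K : numClosedFieldType) (n P1 Q1 : nat) (side : pred 'I_n).
Variables (e f p1 q1 z : 'I_n) (s U S : 'M[K]_n) (t D : 'rV[K]_n) (eps1 eps2 : K).
Variable N : 'I_n -> 'I_n -> 'I_n -> nat.
Local Notation p := P1.*2.+1.
Local Notation q := Q1.*2.+1.
Hypotheses (side_e : side e) (side_f : ~~ side f).
Hypotheses (side_p1 : side p1) (side_q1 : ~~ side q1).
Hypotheses (p1e : p1 != e) (q1f : q1 != f).
Hypotheses (card_side : #|side| = P1.+1) (card_sideC : #|predC side| = Q1.+1).
Hypothesis s_cross : forall i j, side i != side j -> s i j = 0.
Hypothesis s_e : forall l, side l -> s e l != 0.
Hypothesis s_f : forall l, ~~ side l -> s f l != 0.
Hypothesis D_inj : forall i j, D 0 i = D 0 j ->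
  i = j \/ i \in [:: e; f] /\ j \in [:: e; f].
Hypothesis UUt : U *m U^T = 1%:M.
Hypothesis SU : S *m U = U *m s.
Hypothesis tU : diag_mx t *m U = U *m diag_mx D.
Hypothesis S_sym : forall i j, S i j = S j i.
Hypothesis S_unit : S \in unitmx.
Hypothesis verl : forall i j l,
  S i l * S j l = S z l * \sum_m (N i j m)%:R * S m l.
Hypothesis s_sqr : s *m s = diag_mx (\row_l if side l then eps1 else eps2).
Hypotheses (eps1_sqr : eps1 ^+ 2 = 1) (eps2_sqr : eps2 ^+ 2 = 1).
Hypotheses (s_ee : s e e ^+ 2 = eps1 / p%:R) (s_ff : s f f ^+ 2 = eps2 / q%:R).
Hypotheses (lt_PQ : (P1 < Q1)%N) (coprime_pq : coprime p q).

(** If S_zi were 0, the Verlinde relation for j, j would give S_ji^2 = 0 for every j, a zero column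
    of an invertible matrix. *)
Lemma S_unit_row_neq0 i : S z i != 0.
Proof.
apply: contraT => /negPn/eqP Szi.
have S0 j : S j i = 0.
  by apply/eqP; have /eqP := verl j j i; rewrite Szi mul0r mulf_eq0 orbb.
have := congr1 (fun A : 'M[K]_n => A i i) (mulVmx S_unit).
rewrite !mxE eqxx big1 => [/eqP|j _]; first by rewrite eq_sym oner_eq0.
by rewrite S0 mulr0.
Qed.

Let SUt : S = U *m s *m U^T := S_conj UUt SU.

Let V := S *m S.

Lemma V_conj : V = U *m (diag_mx (\row_l if side l then eps1 else eps2)) *m U^T.
Proof.
by rewrite /V {2}SUt !mulmxA SU -s_sqr -!mulmxA.
Qed.

Lemma V_fusion i j : V i j = \sum_m (N i j m)%:R * V z m.
Proof.
rewrite mxE; under [RHS]eq_bigr => m _ do rewrite mxE mulr_sumr.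
rewrite exchange_big /=; apply: eq_bigr => l _.
rewrite [S l j]S_sym verl mulr_sumr; apply: eq_bigr => m _.
by rewrite [S l m]S_sym mulrCA.
Qed.

Let X := diag_mx (\row_l if side l then eps1 else eps2).
Let X_cross i j : side i != side j -> X i j = 0.
Proof.
by move=> ij; rewrite !mxE; case: (eqVneq i j) ij => [->|]; rewrite ?eqxx ?mulr0n.
Qed.
Let Xe l : X l l = if side l then eps1 else eps2.
Proof. by rewrite !mxE eqxx mulr1n. Qed.
Let X_off i j : i != j -> X i j = 0.
Proof. by move=> ij; rewrite !mxE (negPf ij). Qed.

Variables (B : 'I_n) (h : 'I_n -> 'I_n) (u v sg : K).
Hypotheses (uv1 : u ^+ 2 + v ^+ 2 = 1) (u0 : u != 0) (v0 : v != 0).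
Hypotheses (sg2 : sg ^+ 2 = 1) (h_inj : injective h) (he : h e = z) (hf : h f = B).
Hypothesis Uh : forall l, l \notin [:: e; f] -> U (h l) l != 0.
Hypothesis Uz0 : forall l, l \notin [:: e; f] -> U z l = 0.
Hypothesis UB0 : forall l, l \notin [:: e; f] -> U B l = 0.
Hypotheses (Uze : U z e = u) (Uzf : U z f = v).
Hypotheses (UBe : U B e = - sg * v) (UBf : U B f = sg * u).

Let ef : e != f. Proof. by apply: contraNneq side_f => <-. Qed.
Let p1N : p1 \notin [:: e; f].
Proof. by rewrite !inE negb_or p1e; apply: contraNneq side_f => <-. Qed.
Let q1N : q1 \notin [:: e; f].
Proof. by rewrite !inE negb_or q1f andbT; apply: contraNneq side_q1 => ->. Qed.

(** Both entries come from the same entry of row [e] or [f] of [s], which cancels; the ratio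
    remembers only the summand containing [l]. *)
Lemma fusion_ratio l : l \notin [:: e; f] ->
  S B (h l) / S z (h l) = if side l then - sg * v / u else sg * u / v.
Proof.
move=> lN; have ce := conj_e side_e side_f D_inj tU s_cross lN (Uh lN).
rewrite SUt !ce // Uze Uzf UBe UBf.
have U0 := Uh lN.
case: ifP => sl; first by have := s_e sl => ?; field; rewrite u0 U0.
by have := s_f (negbT sl) => ?; field; rewrite v0 U0.
Qed.

Lemma S_zz : S z z = u ^+ 2 * s e e + v ^+ 2 * s f f.
Proof.
rewrite SUt (conj_ef side_e side_f) // Uze Uzf; ring.
Qed.

Lemma S_zB : S z B = sg * u * v * (s f f - s e e).
Proof.
rewrite SUt (conj_ef side_e side_f) // Uze Uzf UBe UBf; ring.
Qed.

Lemma S_BB : S B B = v ^+ 2 * s e e + u ^+ 2 * s f f.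
Proof.
rewrite SUt (conj_ef side_e side_f) // UBe UBf.
transitivity (sg ^+ 2 * (v ^+ 2 * s e e + u ^+ 2 * s f f)); first by ring.
by rewrite sg2 mul1r.
Qed.

Let Nb : 'M[int]_n := \matrix_(j, m) (N B j m)%:Z.
Let chi l := S B l / S z l.

(** The Verlinde relation with first index [B]: the columns of [S] are eigenvectors of the fusion
    matrix of [B]. *)
Lemma fusion_matrix_diag : map_mx intr Nb *m S = S *m diag_mx (\row_l chi l).
Proof.
apply/matrixP => j l; rewrite mul_mx_diag !mxE /chi mulrA [S j l * _]mulrC verl.
rewrite mulrAC mulfV ?S_unit_row_neq0 // mul1r.
by apply: eq_bigr => m _; rewrite !mxE.
Qed.

Lemma char_poly_fusion :
  map_poly intr (char_poly Nb) = \prod_(x <- [seq chi l | l : 'I_n]) ('X - x%:P).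
Proof.
rewrite map_char_poly (char_poly_intertwine S_unit fusion_matrix_diag).
rewrite char_poly_trig ?diag_mx_is_trig // big_image /=.
by apply: eq_bigr => l _; rewrite !mxE eqxx mulr1n.
Qed.

Lemma trace_fusion : \sum_l chi l = (\tr Nb)%:~R.
Proof.
rewrite -[RHS]/(intr _) -(trace_map_mx intr).
have -> : map_mx intr Nb = S *m diag_mx (\row_l chi l) *m invmx S.
  by rewrite -fusion_matrix_diag mulmxK.
rewrite mxtrace_mulC mulmxA mulVmx // mul1mx mxtrace_diag.
by apply: eq_bigr => l _; rewrite mxE.
Qed.

Lemma chi_root l : root (map_poly intr (char_poly Nb)) (chi l).
Proof. by rewrite char_poly_fusion root_prod_XsubC fintype.image_f. Qed.

(** The ratio and its negative inverse are both eigenvalues of an integer matrix. When rational they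
    are integers, and their product is -1. *)
Lemma rational_ratio r : sg * u / v = ratr r ->
  exists2 k : int, sg * u / v = k%:~R /\ - sg * v / u = - k%:~R & k ^+ 2 = 1.
Proof.
move=> kr.
have sg0 : sg != 0 by apply: contra_eq_neq sg2 => ->; rewrite expr0n eq_sym oner_eq0.
have inv : - sg * v / u = - (sg * u / v)^-1.
  have sgV : sg^-1 = sg by apply: (mulfI sg0); rewrite mulfV // -expr2 sg2.
  by rewrite invf_div invfM sgV; field.
have mon := char_poly_monic Nb.
have [k1 k1E] : exists k1 : int, r = k1%:~R.
  apply: (rational_root_int (K := K) mon); rewrite -kr.
  by have := chi_root (h q1); rewrite /chi fusion_ratio // (negPf side_q1).
have [k2 k2E] : exists k2 : int, - r^-1 = k2%:~R.
  apply: (rational_root_int (K := K) mon); rewrite rmorphN fmorphV /= -kr -inv.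
  by have := chi_root (h p1); rewrite /chi fusion_ratio // side_p1.
have r0 : r != 0.
  rewrite -(fmorph_eq0 (@ratr K)) /= -kr.
  by rewrite mulf_neq0 ?invr_eq0 // mulf_neq0.
have k12 : k1 * k2 = -1.
  by apply: (@intr_inj rat); rewrite rmorphM /= -k1E -k2E mulrN mulfV.
have k1_sqr : k1 ^+ 2 = 1.
  have := congr1 absz k12; rewrite abszM => /eqP; rewrite muln_eq1.
  case/andP=> /eqP k1_abs _.
  by have [->|->] : k1 = 1 \/ k1 = -1 by move: k1_abs; clear; lia.
exists k1 => //; rewrite inv kr k1E ratr_int; split=> //.
have kk : (k1%:~R : K) * k1%:~R = 1 by rewrite -intrM -expr2 k1_sqr.
have k0 : (k1%:~R : K) != 0.
  by apply: contra_eq_neq kk => ->; rewrite mul0r eq_sym oner_eq0.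
by congr (- _); apply: (mulfI k0); rewrite mulfV.
Qed.

Lemma rational_ratio_sqr r : sg * u / v = ratr r -> u ^+ 2 = v ^+ 2.
Proof.
case/rational_ratio=> k [kE _] k2; apply/eqP.
have : (sg * u / v) ^+ 2 = 1 by rewrite kE -rmorphXn k2.
rewrite exprMn exprMn sg2 mul1r exprVn => /(canRL (mulfVK _))->.
  by rewrite mul1r.
by rewrite expf_neq0.
Qed.

Lemma eps_eq : eps1 = eps2.
Proof.
have [//|ne] := eqVneq eps1 eps2.
have eps2E : eps2 = - eps1.
  have : (eps1 - eps2) * (eps1 + eps2) = 0.
    by rewrite -subr_sqr eps1_sqr eps2_sqr subrr.
  by move/eqP; rewrite mulf_eq0 subr_eq0 (negPf ne) addrC addr_eq0 => /eqP.
have eps0 : eps1 != 0.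
  by apply: contra_eq_neq eps1_sqr => ->; rewrite expr0n eq_sym oner_eq0.
(* When the signs differ, eps1 [c] and eps1 [w] are the only entries of row [z] of [V] that can be
   nonzero. *)
pose c := u ^+ 2 - v ^+ 2; pose w := - (2 * sg * u * v).
have Vzz : V z z = eps1 * c.
  rewrite V_conj (conj_ef side_e side_f) // -/X !Xe side_e (negPf side_f).
  by rewrite Uze Uzf eps2E /c; ring.
have VzB : V z B = eps1 * w.
  rewrite V_conj (conj_ef side_e side_f) // -/X !Xe side_e (negPf side_f).
  by rewrite Uze Uzf UBe UBf eps2E /w; ring.
have VBB : V B B = - (eps1 * c).
  rewrite V_conj (conj_ef side_e side_f) // -/X !Xe side_e (negPf side_f).
  rewrite UBe UBf eps2E /c.
  by transitivity (sg ^+ 2 * (- (eps1 * (u ^+ 2 - v ^+ 2)))); [ring | rewrite sg2 mul1r].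
have cw : c ^+ 2 + w ^+ 2 = 1.
  transitivity ((u ^+ 2 + v ^+ 2) ^+ 2 + 4 * (sg ^+ 2 - 1) * (u * v) ^+ 2).
    by rewrite /c /w; ring.
  by rewrite uv1 sg2 subrr mulr0 mul0r addr0 expr1n.
have hN l : l \notin [:: e; f] -> (h l != z) /\ (h l != B).
  by move=> lN; split; apply: contraNneq lN; rewrite -?he -?hf => /h_inj->;
    rewrite !inE eqxx ?orbT.
have zB : z != B by rewrite -he -hf (inj_eq h_inj).
have Vz m : m != z -> m != B -> V z m = 0.
  rewrite -(f_finv h_inj m) => mz mB.
  have lN : finv h m \notin [:: e; f].
    by rewrite !inE negb_or; apply/andP; split;
      [apply: contraNneq mz => -> | apply: contraNneq mB => ->]; apply/eqP.
  rewrite V_conj (conj_e side_e side_f D_inj tU X_cross lN (Uh lN)) //.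
  move: lN; rewrite !inE negb_or => /andP[le lf].
  by case: ifP => _; rewrite X_off ?mulr0 ?mul0r // eq_sym.
have Vfus i j : V i j = eps1 * ((N i j z)%:R * c + (N i j B)%:R * w).
  rewrite V_fusion (bigD1 z) //= (bigD1 B) 1?eq_sym //= big1 => [|m /andP[mz mB]].
    by rewrite Vzz VzB addr0; ring.
  by rewrite Vz ?mulr0.
have Vhh l : l \notin [:: e; f] -> V (h l) (h l) = if side l then eps1 else - eps1.
  move=> lN; rewrite V_conj (conj_simple D_inj tU _ _ lN (Uh lN)) (bigD1 l) //=.
  rewrite big1 => [|m ml]; last by rewrite X_off ?mulr0.
  rewrite addr0 -/X Xe mulrAC -expr2 (row_simple_norm D_inj UUt tU lN (Uh lN)).
  by rewrite mul1r eps2E.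
have e1 : (N (h p1) (h p1) z)%:R * c + (N (h p1) (h p1) B)%:R * w = 1.
  by apply: (mulfI eps0); rewrite -Vfus Vhh // side_p1 mulr1.
have e2 : (N (h q1) (h q1) z)%:R * c + (N (h q1) (h q1) B)%:R * w = -1.
  by apply: (mulfI eps0); rewrite -Vfus Vhh // (negPf side_q1) mulrN1.
have e3 : (N B B z).+1%:R * c = - ((N B B B)%:R * w).
  have : (N B B z)%:R * c + (N B B B)%:R * w = - c.
    by apply: (mulfI eps0); rewrite -Vfus VBB mulrN.
  by rewrite -natr1 mulrDl mul1r => /(canRL (addrK _))->; ring.
move: (N B B z) (N B B B) (N (h p1) (h p1) z) (N (h p1) (h p1) B)
  (N (h q1) (h q1) z) (N (h q1) (h q1) B) e1 e2 e3 => m n0 a b a' b' e1 e2 e3.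
(* If [c] is 0 then w^2 = 1, and multiplying [e1] by [e2] gives b b' = -1 for natural numbers. *)
have [c0|c0] := eqVneq c 0.
  move: e1 e2 cw; rewrite c0 !mulr0 !add0r expr0n add0r => e1 e2 w2.
  have /eqP : (b * b').+1%:R = 0 :> K.
    have : b%:R * b'%:R * w ^+ 2 = -1.
      by transitivity ((b%:R * w) * (b'%:R * w)); [ring | rewrite e1 e2 mul1r].
    by rewrite w2 mulr1 -natr1 natrM => ->; rewrite addNr.
  by rewrite pnatr_eq0.
have n00 : (n0%:R : K) != 0.
  apply: contraNneq c0 => n00; move: e3; rewrite n00 mul0r oppr0 => /eqP.
  by rewrite mulf_eq0 pnatr_eq0.
(* The determinant obtained by eliminating [w] from [e1] and [e3]; it makes [c], and then [w],
   rational. *)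
pose d : K := a%:R * n0%:R - b%:R * m.+1%:R.
have cd : c * d = n0%:R.
  transitivity (n0%:R * (a%:R * c + b%:R * w) - b%:R * (m.+1%:R * c + n0%:R * w)).
    by rewrite /d; ring.
  by rewrite e1 e3 addNr mulr0 subr0 mulr1.
have d0 : d != 0 by apply: contraNneq n00 => d0; rewrite -cd d0 mulr0.
pose rc : rat := n0%:R / (a%:R * n0%:R - b%:R * m.+1%:R).
have cE : c = ratr rc.
  by rewrite fmorph_div rmorphB !rmorphM !rmorph_nat -/d -cd mulfK.
clearbody rc.
have wE : w = ratr (- (m.+1%:R * rc) / n0%:R).
  rewrite fmorph_div rmorphN rmorphM /= !ratr_nat -cE e3 opprK mulrC mulKf //.
have sg0 : sg != 0 by apply: contra_eq_neq sg2 => ->; rewrite expr0n eq_sym oner_eq0.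
have w0 : w != 0 by rewrite oppr_eq0 !mulf_neq0 // pnatr_eq0.
(* Half-angle formula: 1 + c = 2 u^2 and w = -2 sg u v, so -(1 + c) / w is the ratio. Its
   rationality forces u^2 = v^2, that is c = 0. *)
have kE : sg * u / v = ratr (- (1 + rc) / (- (m.+1%:R * rc) / n0%:R)).
  rewrite fmorph_div /= -wE rmorphN rmorphD rmorph1 /= -cE -uv1.
  apply: (mulIf v0); apply: (mulIf w0); rewrite mulfVK //.
  rewrite mulrAC [_ / w * v]mulrAC mulfVK // /w /c.
  transitivity (- (2 * sg ^+ 2 * u ^+ 2 * v)); first by ring.
  by rewrite sg2; ring.
by move: c0; rewrite /c (rational_ratio_sqr kE) subrr eqxx.
Qed.

Lemma gap_of_rational_ratio r : sg * u / v = ratr r -> (Q1 <= P1 + 2)%N.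
Proof.
move=> kr; have [k [kE kE'] _] := rational_ratio kr.
have uv := rational_ratio_sqr kr.
(* The trace of the fusion matrix is an integer, and all its eigenvalues besides those at [z] and
   [B] are [k] or [- k]. *)
have [y yE] : exists y : int, chi z + chi B = y%:~R.
  have [y' y'E] : exists y : int, \sum_(l | (l != e) && (l != f)) chi (h l) = y%:~R.
    apply: (big_ind (fun x : K => exists y : int, x = y%:~R)).
    - by exists 0.
    - by move=> _ _ [a ->] [b ->]; exists (a + b); rewrite rmorphD.
    - move=> l /andP[le lf]; rewrite /chi fusion_ratio ?inE ?negb_or ?le //.
      by case: ifP => _; [exists (- k); rewrite kE' rmorphN | exists k].
  exists (\tr Nb - y'); rewrite rmorphB /= -y'E -trace_fusion (reindex_inj h_inj) /=.
  by rewrite (bigD1 e) //= (bigD1 f) 1?eq_sym //= he hf addrA addrK.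
pose a := s e e; pose b := s f f; pose w := sg * u * v.
have w2 : w ^+ 2 = (u ^+ 2) ^+ 2.
  by rewrite /w !exprMn sg2 mul1r -uv expr2.
have zz : S z z = u ^+ 2 * (a + b) by rewrite S_zz -uv -mulrDr.
have BB : S B B = u ^+ 2 * (a + b) by rewrite S_BB -uv -mulrDr.
have u20 : u ^+ 2 != 0 by rewrite expf_neq0.
(* Clears denominators in y = S_zB / S_zz + S_BB / S_zB. *)
have yab : y%:~R * w * (b ^+ 2 - a ^+ 2) = 2 * u ^+ 2 * (a ^+ 2 + b ^+ 2).
  apply: (mulfI u20).
  transitivity (y%:~R * S z z * S z B); first by rewrite zz S_zB -/a -/b -/w; ring.
  rewrite -yE /chi [S B z]S_sym.
  transitivity (S z B ^+ 2 + S B B * S z z).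
    by field; rewrite !S_unit_row_neq0.
  rewrite S_zB BB zz -/a -/b -/w exprMn w2; ring.
have [pK pE] : {x : K | x = p%:R} by exists p%:R.
have [qK qE] : {x : K | x = q%:R} by exists q%:R.
have p0 : pK != 0 by rewrite pE pnatr_eq0.
have q0 : qK != 0 by rewrite qE pnatr_eq0.
have eps10 : eps1 != 0.
  by apply: contra_eq_neq eps1_sqr => ->; rewrite expr0n eq_sym oner_eq0.
have ypq : y%:~R * w * (pK - qK) = 2 * u ^+ 2 * (pK + qK).
  apply: (mulfI eps10); apply: (mulIf (invr_neq0 p0)); apply: (mulIf (invr_neq0 q0)).
  transitivity (y%:~R * w * (eps1 / qK - eps1 / pK)).
    by field; rewrite p0 q0.
  have := yab; rewrite s_ee s_ff -eps_eq -pE -qE => ->.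
  by field; rewrite p0 q0.
(* Squaring removes the undetermined sign in w = +u^2 or -u^2 and leaves an equation between
   integers. *)
have y2 : (y * (p%:Z - q%:Z)) ^+ 2 = (2 * (p%:Z + q%:Z)) ^+ 2.
  apply: (@intr_inj K); rewrite !rmorphXn !rmorphM rmorphB !rmorphD /=.
  rewrite -[p%:~R]/(p%:R) -[q%:~R]/(q%:R) -pE -qE.
  have u40 : (u ^+ 2) ^+ 2 != 0 by rewrite expf_neq0.
  apply: (mulfI u40); rewrite -[in LHS]w2.
  transitivity ((y%:~R * w * (pK - qK)) ^+ 2); first by ring.
  by rewrite ypq; ring.
have dvd : (Q1 - P1 %| p + q)%N.
  have := congr1 absz y2; rewrite !abszX => /eqP; rewrite eqn_exp2r // !abszM.
  have -> : absz (p%:Z - q%:Z)%R = (2 * (Q1 - P1))%N by move: lt_PQ; clear; lia.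
  have -> : absz (p%:Z + q%:Z)%R = (p + q)%N by clear; lia.
  rewrite mulnCA eqn_mul2l /= => /eqP <-.
  by rewrite dvdn_mull.
(* p + q and q - p = 2 (Q1 - P1) are multiples of Q1 - P1, hence so are 2p and 2q, whose gcd is
   2. *)
have : (Q1 - P1 %| 2)%N.
  have : gcdn (2 * p) (2 * q) = 2%N by rewrite -muln_gcdr (eqP coprime_pq).
  move=> <-; rewrite dvdn_gcd.
  have dvd2 : (Q1 - P1 %| (Q1 - P1).*2)%N by rewrite -muln2 dvdn_mulr.
  have -> : (2 * p = p + q - (Q1 - P1).*2)%N by move: lt_PQ; clear; lia.
  have -> : (2 * q = p + q + (Q1 - P1).*2)%N by move: lt_PQ; clear; lia.
  by apply/andP; split; [exact: dvdn_sub | exact: dvdn_add].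
move/(dvdn_leq (isT : (0 < 2)%N)); move: lt_PQ; clear; lia.
Qed.

Lemma gap_bound : (Q1 <= P1 + 2)%N.
Proof.
have [[r kr]|] : (exists r, sg * u / v = ratr r) \/
    ((mup (sg * u / v)
        (map_poly ratr (map_poly intr (char_poly Nb) : {poly rat}))).*2
      < size (map_poly intr (char_poly Nb) : {poly rat}))%N.
  apply: rat_or_large_degree; rewrite -size_poly_eq0 size_map_poly_id0 //.
    by rewrite size_poly_eq0 monic_neq0 // char_poly_monic.
  by rewrite (eqP (char_poly_monic Nb)) oner_eq0.
  exact: gap_of_rational_ratio kr.
have -> : map_poly ratr (map_poly intr (char_poly Nb) : {poly rat}) =
    map_poly intr (char_poly Nb) :> {poly K}.
  by rewrite -map_poly_comp; apply: eq_map_poly => k /=; rewrite ratr_int.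
rewrite size_map_poly_id0; last first.
  by rewrite (eqP (char_poly_monic Nb)) oner_eq0.
rewrite size_char_poly char_poly_fusion mu_prod_XsubC.
have nE : n = (P1.+1 + Q1.+1)%N.
  by rewrite -card_side -card_sideC cardC card_ord.
have cQ : #|[pred l | ~~ side l & l != f]| = Q1.
  have := cardD1 f (predC side); rewrite card_sideC [f \in _]side_f add1n => -[->].
  by apply: eq_card => l; rewrite !inE andbC.
(* The indices off [side] other than [f] all give this eigenvalue. The polynomial has size P1 + Q1 +
   3, so 2 Q1 < P1 + Q1 + 3. *)
have : (Q1 <= count_mem (sg * u / v) [seq chi l | l : 'I_n])%N.
  rewrite -cQ count_map -[X in (X <= _)%N](fintype.card_image h_inj).
  rewrite -size_filter cardE; apply: uniq_leq_size; first exact: enum_uniq.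
  move=> i; rewrite mem_enum => /fintype.imageP[l]; rewrite inE => /andP[sl lf] ->.
  rewrite mem_filter mem_enum andbT /= /chi fusion_ratio ?(negPf sl) //.
  by rewrite !inE negb_or lf andbT; apply: contraNneq sl => ->.
move: (count_mem _ _) => cnt; rewrite nE; clear; lia.
Qed.

End Gap.

(** * Assembling the bound for a direct sum of two matrix representations *)

Section Representation.
Variables (K : numClosedFieldType) (P1 Q1 m d1 d2 : nat).
Variables (s1 : 'M[K]_d1) (s2 : 'M[K]_d2) (D1 : 'rV[K]_d1) (D2 : 'rV[K]_d2).
Variables (e1 : 'I_d1) (e2 : 'I_d2) (eps1 eps2 : K).
Hypotheses (d1E : d1 = P1.+1) (d2E : d2 = Q1.+1) (P1_gt0 : (0 < P1)%N) (lt_PQ : (P1 < Q1)%N).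
Hypothesis coprime_pq : coprime P1.*2.+1 Q1.*2.+1.
Hypotheses (s1_sym : s1^T = s1) (s2_sym : s2^T = s2).
Hypotheses (s1_e : forall l, s1 e1 l != 0) (s2_e : forall l, s2 e2 l != 0).
Hypotheses (D1_inj : injective (D1 0)) (D2_inj : injective (D2 0)).
Hypothesis D12 : forall i j, D1 0 i = D2 0 j -> i = e1 /\ j = e2.
Hypotheses (eps1_sqr : eps1 ^+ 2 = 1) (eps2_sqr : eps2 ^+ 2 = 1).
Hypotheses (s1_ee : s1 e1 e1 ^+ 2 = eps1 / P1.*2.+1%:R)
  (s2_ee : s2 e2 e2 ^+ 2 = eps2 / Q1.*2.+1%:R).
Hypotheses (s1_sqr : (s1 *m s1) e1 e1 = eps1) (s2_sqr : (s2 *m s2) e2 e2 = eps2).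

Let side : pred 'I_(d1 + d2) := fun i => (i < d1)%N.
Let e := lshift d2 e1.
Let f := rshift d1 e2.
Let s := block_mx s1 0 0 s2.
Let D := row_mx D1 D2.

Let side_l i : side (lshift d2 i). Proof. by rewrite /side /= ltn_ord. Qed.
Let side_r i : ~~ side (rshift d1 i).
Proof. by rewrite /side /= -leqNgt leq_addr. Qed.

Let ex_neq d (i : 'I_d) : (1 < d)%N -> exists j, j != i.
Proof.
case: d i => [|[|d]] // i _; have [->|i0] := eqVneq i ord0.
  by exists ord_max.
by exists ord0; rewrite eq_sym.
Qed.

Let s_cross i j : side i != side j -> s i j = 0.
Proof.
case: (split_ordP i) => a ->; case: (split_ordP j) => b ->;
  rewrite ?side_l ?(negPf (side_r _)) //= => _.
  by rewrite block_mxEur mxE.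
by rewrite block_mxEdl mxE.
Qed.

Let s_sym : s^T = s.
Proof. by rewrite tr_block_mx s1_sym s2_sym !trmx0. Qed.

Let s_e l : side l -> s e l != 0.
Proof.
by case: (split_ordP l) => a ->; rewrite ?(negPf (side_r _)) // block_mxEul.
Qed.

Let s_f l : ~~ side l -> s f l != 0.
Proof.
by case: (split_ordP l) => a ->; rewrite ?side_l // block_mxEdr.
Qed.

Let D_inj i j : D 0 i = D 0 j -> i = j \/ i \in [:: e; f] /\ j \in [:: e; f].
Proof.
case: (split_ordP i) => a ->; case: (split_ordP j) => b ->;
  rewrite ?row_mxEl ?row_mxEr.
- by move/D1_inj->; left.
- by case/D12=> -> ->; right; rewrite !inE !eqxx orbT.
- by move/esym/D12 => [-> ->]; right; rewrite !inE !eqxx orbT.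
- by move/D2_inj->; left.
Qed.

Let card_side : #|side| = P1.+1.
Proof.
rewrite -d1E -[RHS]card_ord -(fintype.card_image (@lshift_inj d1 d2)).
apply: eq_card => i; apply/idP/fintype.imageP => [|[a _ ->]]; last exact: side_l.
rewrite -topredE /=; case: (split_ordP i) => a ->; first by exists a.
by rewrite (negPf (side_r a)).
Qed.

Let card_sideC : #|predC side| = Q1.+1.
Proof.
apply/eqP; rewrite -(eqn_add2l P1.+1) -{1}card_side cardC card_ord.
by apply/eqP; congr (_ + _)%N.
Qed.

Theorem representation_gap (S : 'M[K]_m) (t : 'rV[K]_m) (z : 'I_m)
    (N : 'I_m -> 'I_m -> 'I_m -> nat) (Q : 'M[K]_(m, d1 + d2)) :
    m = (d1 + d2)%N -> row_free Q -> (forall i j, S i j = S j i) ->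
    S \in unitmx ->
    (forall i j l, S i l * S j l = S z l * \sum_a (N i j a)%:R * S a l) ->
    S *m S *m diag_mx t = diag_mx t *m (S *m S) ->
    S *m Q = Q *m block_mx s1 0 0 s2 ->
    diag_mx t *m Q = Q *m diag_mx (row_mx D1 D2) ->
  eps1 = eps2 /\ (Q1 <= P1 + 2)%N.
Proof.
rewrite -/s -/D => mE; subst m; rewrite row_free_unit => Q_unit S_sym S_unit.
move=> verl S_sqr SQ tQ.
have [a1 a1e] : exists a1, a1 != e1 by apply: ex_neq; rewrite d1E ltnS.
have [a2 a2e] : exists a2, a2 != e2.
  by apply: ex_neq; rewrite d2E ltnS; apply: leq_ltn_trans lt_PQ.
pose p1 := lshift d2 a1; pose q1 := rshift d1 a2.
have p1e : p1 != e by rewrite (inj_eq (@lshift_inj _ _)).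
have q1f : q1 != f by rewrite (inj_eq (@rshift_inj _ _)).
have side_e : side e := side_l e1; have side_f : ~~ side f := side_r e2.
have side_p1 : side p1 := side_l a1; have side_q1 : ~~ side q1 := side_r a2.
have St : S^T = S by apply/matrixP => i j; rewrite mxE S_sym.
(* The square of [S] commutes with [t], so [commutant_diag] applies to [s *m s]; one diagonal entry
   per block then determines it. *)
have s_sqr : s *m s = diag_mx (\row_l if side l then eps1 else eps2).
  have ssE : s *m s = block_mx (s1 *m s1) 0 0 (s2 *m s2).
    by rewrite mulmx_block !mul0mx !mulmx0 !addr0 !add0r.
  have se : (s *m s) e e = eps1 by rewrite ssE block_mxEul.
  have sf : (s *m s) f f = eps2 by rewrite ssE block_mxEdr.
  rewrite (commutant_diag (A := s *m s) side_e side_f side_q1 q1f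
    s_cross s_e s_f D_inj).
  - by rewrite se sf.
  - by rewrite trmx_mul s_sym.
  - by rewrite mulmxA.
  - apply: (can_inj (mulKmx Q_unit)).
    have SSQ : Q *m (s *m s) = S *m S *m Q by rewrite mulmxA -SQ -mulmxA -SQ mulmxA.
    transitivity (S *m S *m diag_mx t *m Q).
      by rewrite mulmxA SSQ -[_ *m Q *m _]mulmxA -tQ mulmxA.
    by rewrite S_sqr -[_ *m Q]mulmxA -SSQ mulmxA tQ -mulmxA.
have [U [UUt SU tU]] := orthogonal_intertwiner side_e side_f side_q1 q1f
  s_sym s_cross s_e s_f D_inj St Q_unit SQ tQ.
have Sz := S_unit_row_neq0 S_unit verl.
have [B [h [u [v [sg [[uv1 u0 v0 sg2] [h_inj he hf Uh]]]]]]] :=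
  intertwiner_shape side_e side_f side_p1 side_q1 p1e q1f s_cross D_inj UUt SU tU Sz.
case=> UzB Uze Uzf UBe UBf.
have Uz0 l lN := proj1 (UzB l lN); have UB0 l lN := proj2 (UzB l lN).
have see : s e e ^+ 2 = eps1 / P1.*2.+1%:R by rewrite block_mxEul.
have sff : s f f ^+ 2 = eps2 / Q1.*2.+1%:R by rewrite block_mxEdr.
split; first exact: (eps_eq side_e side_f side_p1 side_q1 p1e q1f s_cross s_e s_f
  D_inj UUt SU tU S_sym S_unit verl s_sqr eps1_sqr eps2_sqr uv1 u0 v0 sg2 h_inj he
  hf Uh Uz0 UB0 Uze Uzf UBe UBf).
exact: (gap_bound side_e side_f side_p1 side_q1 p1e q1f card_side card_sideC
  s_cross s_e s_f D_inj UUt SU tU S_sym S_unit verl s_sqr eps1_sqr eps2_sqr see sff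
  lt_PQ coprime_pq uv1 u0 v0 sg2 h_inj he hf Uh Uz0 UB0 Uze Uzf UBe UBf).
Qed.

End Representation.

(** * Roots of unity and Legendre symbols *)

Section RootOfUnity.
Variable R : realType.

Lemma cos_sinX (x : R) n :
  Complex (cos x) (sin x) ^+ n = Complex (cos (x *+ n)) (sin (x *+ n)).
Proof.
elim: n => [|n IHn]; first by rewrite expr0 mulr0n cos0 sin0.
rewrite exprS IHn mulrS cosD sinD.
by apply/eqP; rewrite eq_complex; apply/andP; split; apply/eqP => /=; ring.
Qed.

(** The order divides the prime [p]; order 1 would make sin(2 pi / p) vanish, although 0 < 2 pi / p
    < pi. *)
Lemma zeta_primitive p : prime p -> odd p -> p.-primitive_root (zeta R p).
Proof.
move=> p_pr p_odd; have p_gt2 : (2 < p)%N by apply: odd_prime_gt2.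
have p_gt0 : 0 < p%:R :> R by rewrite ltr0n prime_gt0.
have zp : zeta R p ^+ p = 1.
  rewrite cos_sinX -(mulr_natr (2 * pi / p%:R)) mulfVK ?gt_eqF // mulr_natl.
  by rewrite cos2pi sin2pi.
have [m zm dvd_mp] := prim_order_exists (prime_gt0 p_pr) zp.
have /primeP[_ /(_ m dvd_mp)/orP[/eqP m1|/eqP mp]] := p_pr; last by rewrite mp in zm.
have := prim_expr_order zm; rewrite m1 expr1 => /eqP.
rewrite eq_complex /= => /andP[_ /eqP s0].
have : 0 < sin (2 * pi / p%:R : R).
  apply: sin_gt0_pi; rewrite divr_gt0 ?mulr_gt0 ?pi_gt0 //=.
  by rewrite ltr_pdivrMr // mulrC ltr_pM2l ?pi_gt0 // (ltr_nat _ 2).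
by rewrite s0 ltxx.
Qed.

End RootOfUnity.

Lemma prim_root_exprz (F : fieldType) (x : F) p (k : int) :
  p.-primitive_root x -> (x ^ k == 1) = (p %| k)%Z.
Proof.
move=> px; rewrite /dvdz /=; case: k => n /=; first by rewrite -(prim_order_dvd px).
by rewrite NegzE -exprnN invr_eq1 -(prim_order_dvd px).
Qed.

(** p divides (j - l)(j + l), and both indices are at most (p - 1)/2. *)
Lemma prim_root_quadratic_inj (F : fieldType) (x : F) p (a : int) (j l : nat) :
  prime p -> odd p -> coprimez a p -> p.-primitive_root x ->
  (j < p.+1./2)%N -> (l < p.+1./2)%N ->
  x ^ (a * j%:Z ^+ 2) = x ^ (a * l%:Z ^+ 2) -> j = l.
Proof.
move=> p_pr p_odd cop px lt_j lt_l e.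
have x0 : x != 0.
  apply: contra_eq_neq (prim_expr_order px) => ->.
  by rewrite expr0n gtn_eqF ?prime_gt0 // eq_sym oner_eq0.
have : x ^ (a * (j%:Z ^+ 2 - l%:Z ^+ 2)) == 1.
  by rewrite mulrBr expfzDr // e -invr_expz mulfV // expfz_neq0.
rewrite (prim_root_exprz _ px) Gauss_dvdzr; last by rewrite coprimez_sym.
rewrite subr_sqr dvdzE abszM Euclid_dvdM // => /orP[] d.
  have [//|] := eqVneq j l; move=> jl.
  have := dvdn_leq _ d; lia.
have [|] := posnP (j + l); first by lia.
move=> jl; have := dvdn_leq _ d; lia.
Qed.

(** Raising to the power q turns the right side into 1, so p divides a j^2 q and hence j. *)
Lemma prim_root_quadratic_common (F : fieldType) (x y : F) p q (a b : int) (j l : nat) :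
  prime p -> prime q -> p != q -> coprimez a p -> p.-primitive_root x ->
  q.-primitive_root y -> (j < p)%N ->
  x ^ (a * j%:Z ^+ 2) = y ^ (b * l%:Z ^+ 2) -> j = 0%N.
Proof.
move=> p_pr q_pr pq cop px qy lt_j e.
have : x ^ (a * j%:Z ^+ 2 * q%:Z) == 1.
  by rewrite -exprz_exp e exprz_exp (prim_root_exprz _ qy) dvdz_mull.
rewrite (prim_root_exprz _ px) -mulrA Gauss_dvdzr; last by rewrite coprimez_sym.
rewrite dvdzE !abszM !Euclid_dvdM // orbb [(p %| q)%N](dvdn_prime2 p_pr q_pr).
rewrite (negPf pq) orbF /=.
by case: j lt_j {e} => // j lt_j /(dvdn_leq (ltn0Sn j)); rewrite leqNgt lt_j.
Qed.

Section Legendre.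
Variable p : nat.
Hypotheses (p_pr : prime p) (p_odd : odd p).

(** Passes to the field ['F_p], which is ['Z_(pdiv p)]. *)
Lemma legendreE a : legendre p a =
  if a%:~R == 0 :> 'F_p then 0
  else if [exists x : 'F_p, x ^+ 2 == a%:~R] then 1 else -1.
Proof. by rewrite -{1}(pdiv_id p_pr). Qed.

Lemma intr_Fp_eq0 (a : int) : (a%:~R == 0 :> 'F_p) = (p %| a)%Z.
Proof.
rewrite dvdzE /= (dvdn_pcharf (pchar_Fp p_pr)).
by case: a => n //=; rewrite NegzE rmorphN oppr_eq0.
Qed.

Lemma legendre_neq0 a : coprimez a p -> legendre p a != 0.
Proof.
move=> cop; rewrite legendreE intr_Fp_eq0.
case: ifP => [d|_]; last by case: ifP.
move: cop; rewrite /coprimez /gcdz /= => /eqP[] /eqP.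
by rewrite -/(coprime _ _) coprime_sym prime_coprime // => /negP[].
Qed.

Lemma legendreN1 : legendre p (-1) = if (p %% 4 == 1)%N then 1 else -1.
Proof.
rewrite legendreE intr_Fp_eq0 dvdzE abszN1 dvdn1.
have -> : (p == 1)%N = false by apply/negbTE; rewrite neq_ltn prime_gt1 ?orbT.
have card_F : #|'F_p| = p by apply: card_Fp.
have two0 : (2%:R : 'F_p) != 0.
  rewrite -(dvdn_pcharf (pchar_Fp p_pr)); apply/negP => /(@dvdn_leq _ 2 isT).
  by rewrite leqNgt odd_prime_gt2.
have fermat (x : 'F_p) : x != 0 -> x ^+ p.-1 = 1.
  move=> x0; apply: (mulfI x0); rewrite -exprS prednK ?prime_gt0 // mulr1.
  by have := expf_card x; rewrite card_F.
congr (if _ then _ else _); apply/existsP/eqP => [[x /eqP x2]|p1].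
  have x0 : x != 0.
    apply: contra_eq_neq x2 => ->; rewrite expr0n /= eq_sym rmorphN oppr_eq0.
    exact: oner_neq0.
  apply/eqP; apply: contraT => p3; have := fermat x x0.
  have -> : p.-1 = (2 * p.-1./2)%N by lia.
  have k_odd : odd p.-1./2 by lia.
  rewrite exprM x2 mulrN1z -signr_odd k_odd expr1 => /eqP.
  by rewrite eq_sym -subr_eq0 opprK -[1 + 1]/(2%:R) (negPf two0).
pose k := (p.-1)./2.
have k_gt0 : (0 < k)%N by move: (odd_prime_gt2 p_odd p_pr); rewrite /k; lia.
(* With k = (p - 1)/2, the polynomial X^k - 1 has too few roots to vanish on all units. For such
   [x], x^k = -1, and k is even. *)
have [x x0 xk] : exists2 x : 'F_p, x != 0 & x ^+ k != 1.
  apply/exists_inP; apply: contraT; rewrite negb_exists_in => /forall_inP all1.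
  have := @max_poly_roots _ ('X^k - 1) (enum [pred x : 'F_p | x != 0]).
  rewrite -size_poly_eq0 size_XnsubC // => /(_ isT).
  rewrite enum_uniq => h.
  have /h/(_ isT) : all (root ('X^k - 1 : {poly 'F_p})) (enum [pred x : 'F_p | x != 0]).
    apply/allP => x; rewrite mem_enum inE => x0.
    by rewrite rootE !hornerE subr_eq0; apply: negbNE; apply: all1.
  rewrite -cardE; have -> : #|[pred x : 'F_p | x != 0]| = p.-1.
    by have := cardC1 (0 : 'F_p); rewrite card_F => <-; apply: eq_card.
  by rewrite /k; lia.
exists (x ^+ (k./2)); rewrite -exprM rmorphN /=.
have -> : (k./2 * 2 = k)%N by rewrite /k; lia.
have : (x ^+ k - 1) * (x ^+ k + 1) = 0.
  rewrite -subr_sqr expr1n -exprM.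
  have -> : (k * 2 = p.-1)%N by rewrite /k; lia.
  by rewrite fermat // subrr.
by move/eqP; rewrite mulf_eq0 subr_eq0 (negPf xk) addr_eq0.
Qed.

Lemma legendreN1_sqr : legendre p (-1) ^+ 2 = 1.
Proof. by rewrite legendreN1; case: ifP. Qed.

End Legendre.

(** * Entries and eigenvalues of the matrices of rho_{p,a} *)

Section RhoMatrices.
Variables (R : realType) (p : nat) (a : int).
Hypotheses (p_pr : prime p) (p_odd : odd p) (cop : coprimez a p).
Local Notation eps := ((legendre p (-1))%:~R : R[i]).

Lemma half_succ : p.+1./2 = p./2.+1.
Proof. by move: p_odd; clear; lia. Qed.

Lemma rho_s_sym : (rho_s R p a)^T = rho_s R p a.
Proof.
apply/matrixP => j l; rewrite !mxE andbC orbC.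
by rewrite [_ * l%:R * j%:R]mulrAC.
Qed.

Lemma rho_beta_sqr : rho_beta R p a ^+ 2 = eps / p%:R.
Proof.
rewrite exprMn sqrtCK -[RHS]mul1r; congr (_ * _).
have := legendre_neq0 p_pr cop; rewrite -rmorphXn /= /legendre.
by case: ifP => [_|_ _]; [rewrite eqxx | case: ifP].
Qed.

Lemma eps_sqr : eps ^+ 2 = 1.
Proof. by rewrite -rmorphXn legendreN1_sqr. Qed.

Lemma rho_beta_neq0 : rho_beta R p a != 0.
Proof.
have p0 : (p%:R : R[i]) != 0 by rewrite pnatr_eq0 -lt0n prime_gt0.
have eps0 : eps != 0.
  by apply: contra_eq_neq eps_sqr => ->; rewrite expr0n eq_sym oner_eq0.
apply: contra_eq_neq rho_beta_sqr => ->.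
by rewrite expr0n eq_sym mulf_neq0 ?invr_eq0.
Qed.

Variable z : 'I_p.+1./2.
Hypothesis z0 : z = 0%N :> nat.

Lemma rho_s_zz : rho_s R p a z z = rho_beta R p a.
Proof. by rewrite mxE z0. Qed.

Lemma rho_s_zl l : l != z -> rho_s R p a z l = sqrtC 2 * rho_beta R p a.
Proof.
move=> lz; have l0 : (l == 0%N :> nat) = false by rewrite -z0; apply: negPf.
by rewrite mxE z0 l0.
Qed.

Lemma rho_s_z_neq0 l : rho_s R p a z l != 0.
Proof.
have [->|lz] := eqVneq l z; first by rewrite rho_s_zz rho_beta_neq0.
by rewrite rho_s_zl // mulf_neq0 ?rho_beta_neq0 // sqrtC_eq0 pnatr_eq0.
Qed.

(** Row 0 gives beta^2 (1 + 2 (p - 1)/2) = beta^2 p, so no cosine sum has to be evaluated. *)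
Lemma rho_s_sqr_zz : (rho_s R p a *m rho_s R p a) z z = eps.
Proof.
have p0 : (p%:R : R[i]) != 0 by rewrite pnatr_eq0 -lt0n prime_gt0.
have cz : #|predC1 z| = p./2 by rewrite cardC1 card_ord half_succ.
have sE l : rho_s R p a l z = rho_s R p a z l by rewrite -{1}rho_s_sym mxE.
rewrite mxE (bigD1 z) //= (eq_bigr (fun=> 2 * rho_beta R p a ^+ 2)) => [|l lz].
  rewrite sumr_const rho_s_zz -expr2 cz.
  have pE : (p%:R : R[i]) = 1 + 2 * p./2%:R.
    by rewrite -natrM -(natrD _ 1); congr (_%:R); move: p_odd; clear; lia.
  transitivity (rho_beta R p a ^+ 2 * p%:R); first by rewrite pE; ring.
  by rewrite rho_beta_sqr mulfVK.
by rewrite sE rho_s_zl // -expr2 exprMn sqrtCK.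
Qed.

Lemma rho_t_inj :
  injective (fun j : 'I_p.+1./2 => zeta R p ^ (a * (j%:Z ^+ 2))).
Proof.
move=> j l /(prim_root_quadratic_inj p_pr p_odd cop (zeta_primitive R p_pr p_odd)
  (ltn_ord j) (ltn_ord l)) jl.
exact: val_inj.
Qed.

End RhoMatrices.

(** * Relations in SL(2,Z) and the conclusion *)

Section ModularGroup.

Lemma det_mx2 (A : comPzRingType) (a b c d : A) : \det (mx2 a b c d) = a * d - b * c.
Proof.
rewrite (expand_det_row _ ord0) !big_ord_recl big_ord0 /cofactor !det_mx11 !mxE /=.
by rewrite addr0 !expr0 !expr1 mul1r; ring.
Qed.

Lemma sl2s_in : sl2s \in SL2Z.
Proof. by rewrite inE det_mx2. Qed.

Lemma sl2t_in : sl2t \in SL2Z.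
Proof. by rewrite inE det_mx2. Qed.

Lemma SL2Z_mul M N : M \in SL2Z -> N \in SL2Z -> M *m N \in SL2Z.
Proof. by rewrite !inE det_mulmx => /eqP-> /eqP->. Qed.

Lemma sl2s_sqr : sl2s *m sl2s = - 1%:M.
Proof.
apply/matrixP => i j; rewrite !mxE !big_ord_recl big_ord0 !mxE.
by case: i => [[|[|]]] // ?; case: j => [[|[|]]].
Qed.

End ModularGroup.

(** The Verlinde relation is homogeneous in [S], so it survives the rescaling by [x]; the square of
    [S] is the image of the central element -1, hence commutes with [t]. *)
Lemma modular_lift_data (k : closedFieldType) (C : modularFusion k)
    (rho : 'M[int]_2 -> 'M[k]_(num_simple C)) : modular_lift rho ->
  let S := rho sl2s in
  exists (t : 'rV[k]_(num_simple C)) (z : 'I_(num_simple C))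
    (N : 'I_(num_simple C) -> 'I_(num_simple C) -> 'I_(num_simple C) -> nat),
  [/\ rho sl2t = diag_mx t, forall i j, S i j = S j i, S \in unitmx,
      forall i j l, S i l * S j l = S z l * \sum_m (N i j m)%:R * S m l
    & S *m S *m diag_mx t = diag_mx t *m (S *m S)].
Proof.
move=> [[rho1 rhoM] [x Sx] [y Ty]] S.
have [z [N NP]] := verlinde C.
have sqr_in : - 1%:M \in SL2Z by rewrite -sl2s_sqr SL2Z_mul ?sl2s_in.
have SS : S *m S = rho (- 1%:M) by rewrite -rhoM ?sl2s_in // sl2s_sqr.
have tE : rho sl2t = diag_mx (y *: \row_i twist (simple_rep C i)).
  by rewrite Ty linearZ.
have SE a b : S a b = x * Smatrix C a b by rewrite /S Sx mxE.
exists (y *: \row_i twist (simple_rep C i)), z, N; split=> //.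
- by move=> i j; rewrite !SE Smatrix_sym.
(* The fourth power of [S] is the image of 1, so [S] is invertible without assuming the scalar [x]
   nonzero. *)
- have : S *m (S *m S *m S) = 1%:M.
    rewrite !mulmxA SS -mulmxA SS -rhoM // mulNmx mul1mx opprK; exact: rho1.
  by case/mulmx1_unit.
- move=> i j l; rewrite !SE mulrACA NP.
  under [in RHS]eq_bigr => m _ do rewrite SE mulrCA.
  by rewrite -mulr_sumr mulrACA.
- by rewrite -tE SS -!rhoM ?sl2t_in // mulNmx mulmxN mul1mx mulmx1.
Qed.

Theorem theorem3p2 (R : realType) (p q : nat)
    (p_prime : prime p) (q_prime : prime q) (p_odd : odd p) (q_odd : odd q)
    (lt_pq : (p < q)%N)
    (rho1 : mx_representation R[i] (SL2Zn p) p.+1./2)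
    (rho2 : mx_representation R[i] (SL2Zn q) q.+1./2)
    (irr1 : mx_irreducible rho1) (irr2 : mx_irreducible rho2)
    (form1 : exists2 a1 : int, coprimez a1 p & is_rho a1 rho1)
    (form2 : exists2 a2 : int, coprimez a2 q & is_rho a2 rho2)
    (ex_C : exists C : modularFusion R[i],
       modular_rep_iso C (dsum (inflate rho1) (inflate rho2))) :
  (q - p = 4)%N.
Proof.
have [a1 cop1 [A1 A1u [sA1 tA1]]] := form1.
have [a2 cop2 [A2 A2u [sA2 tA2]]] := form2.
have [C [rho lift_rho [P [mE P_free rhoP]]]] := ex_C.
have [t [z [N [tE S_sym S_unit verl S_sqr]]]] := modular_lift_data lift_rho.
(* [Q] composes the two changes of basis: simple objects to the direct sum, then to the explicit
   matrices. *)
pose A := block_mx A1 0 0 A2; pose Q := P *m A.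
have A_unit : A \in unitmx by rewrite unitmxE det_ublock unitrM -!unitmxE A1u.
have Q_free : row_free Q.
  by rewrite /row_free mxrankMfree // row_free_unit.
have pE : p = p./2.*2.+1 by move: p_odd; clear; lia.
have qE : q = q./2.*2.+1 by move: q_odd; clear; lia.
have lt_half : (p./2 < q./2)%N by move: p_odd q_odd lt_pq; clear; lia.
have p2_gt0 : (0 < p./2)%N by move: (odd_prime_gt2 p_odd p_prime); clear; lia.
have ltz1 : (0 < p.+1./2)%N by rewrite half_succ.
have ltz2 : (0 < q.+1./2)%N by rewrite half_succ.
pose z1 : 'I_p.+1./2 := Ordinal ltz1; pose z2 : 'I_q.+1./2 := Ordinal ltz2.
have pq : p != q by rewrite ltn_eqF.
have cop_pq : coprime p./2.*2.+1 q./2.*2.+1.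
  by rewrite -pE -qE prime_coprime // dvdn_prime2.
have SQ : rho sl2s *m Q = Q *m block_mx (rho_s R p a1) 0 0 (rho_s R q a2).
  rewrite /Q mulmxA rhoP ?sl2s_in // -!mulmxA; congr (_ *m _).
  by rewrite !mulmx_block !mul0mx !mulmx0 !addr0 !add0r sA1 sA2.
pose D1 : 'rV[R[i]]_p.+1./2 := \row_j (zeta R p ^ (a1 * (j%:Z ^+ 2))).
pose D2 : 'rV[R[i]]_q.+1./2 := \row_j (zeta R q ^ (a2 * (j%:Z ^+ 2))).
have tQ : diag_mx t *m Q = Q *m diag_mx (row_mx D1 D2).
  rewrite -tE /Q mulmxA rhoP ?sl2t_in // -!mulmxA; congr (_ *m _).
  by rewrite diag_mx_row !mulmx_block !mul0mx !mulmx0 !addr0 !add0r tA1 tA2.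
have D1_inj : injective (D1 0).
  by move=> j l; rewrite !mxE => /(rho_t_inj p_prime p_odd cop1).
have D2_inj : injective (D2 0).
  by move=> j l; rewrite !mxE => /(rho_t_inj q_prime q_odd cop2).
have zp := zeta_primitive R p_prime p_odd; have zq := zeta_primitive R q_prime q_odd.
have D12 i j : D1 0 i = D2 0 j -> i = z1 /\ j = z2.
  rewrite !mxE => e; split; apply: val_inj => /=.
    apply: (prim_root_quadratic_common p_prime q_prime pq cop1 zp zq _ e).
    by move: (ltn_ord i) p_odd; clear; lia.
  apply: (prim_root_quadratic_common q_prime p_prime _ cop2 zq zp _ (esym e)).
    by rewrite eq_sym.
  by move: (ltn_ord j) q_odd; clear; lia.
have bp := rho_beta_sqr R p_prime cop1; have bq := rho_beta_sqr R q_prime cop2.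
have [] := representation_gap (half_succ p_odd) (half_succ q_odd) p2_gt0 lt_half
  cop_pq (rho_s_sym R p a1) (rho_s_sym R q a2)
  (rho_s_z_neq0 R p_prime p_odd cop1 (z := z1) erefl)
  (rho_s_z_neq0 R q_prime q_odd cop2 (z := z2) erefl)
  D1_inj D2_inj D12 (eps_sqr R p_prime p_odd) (eps_sqr R q_prime q_odd) _ _
  (rho_s_sqr_zz R p_prime p_odd cop1 (z := z1) erefl)
  (rho_s_sqr_zz R q_prime q_odd cop2 (z := z2) erefl)
  mE Q_free S_sym S_unit verl S_sqr SQ tQ.
- by rewrite rho_s_zz // bp -pE.
- by rewrite rho_s_zz // bq -qE.
(* Equal signs mean p = q mod 4; with 0 < q - p <= 4 only 4 remains. *)
move=> /intr_inj; rewrite !legendreN1 //.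
by case: eqP => p4; case: eqP => q4 // _; move: p4 q4 p_odd q_odd lt_pq; clear; lia.
Qed.
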